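(* Let $\mathcal{F}$ be a singular foliation at $(\mathbb{C}^2,p)$. Let $\mathcal{B}=\mathcal{B}_0-\mathcal{B}_\infty$ be a reduced balanced divisor of separatrices for $\mathcal{F}$. Then $$GSV_p(\mathcal{F},\mathcal{B}_0)=i_p(\mathcal{P}^{\mathcal{F}},\mathcal{B}_0)-\mu_p(\mathcal{B}_0)-\nu_p(\mathcal{B}_0)+1.$$
   Context: **Foliations.** A singular foliation $\mathcal F$ at $(\mathbb C^2,p)$ is given, in coordinates $(x,y)$ centered at $p$, by a (holomorphic or formal) 1-form $\omega=P\,dx+Q\,dy$ with $P,Q\in\mathbb C[[x,y]]$ relatively prime and vanishing at $p$, or by the dual vector field $v=-Q\,\partial_x+P\,\partial_y$. $i_p(g,h)=\dim_{\mathbb C}\mathbb C[[x,y]]/(g,h)$ is the intersection number of curves $g=0$, $h=0$. A curve $f=0$ is $\mathcal F$-invariant if $\omega\wedge df=fh\,dx\wedge dy$ for some $h\in\mathbb C[[x,y]]$. A separatrix is an irreducible (possibly formal) invariant curve; $\mathrm{Sep}_p(\mathcal F)$ is the set of separatrices. For a reduced curve $C:f=0$, $\nu_p(C)$ is its algebraic multiplicity and $\mu_p(C)=i_p(\partial_xf,\partial_yf)$ its Milnor number; a reduced effective divisor is identified with the corresponding reduced curve. The generic polar $\mathcal P^{\mathcal F}$ is the curve $aP+bQ=0$ for generic $(a:b)\in\mathbb P^1(\mathbb C)$. **Reduction of singularities.** A singularity is reduced if the linear part of $v$ is non-zero with eigenvalues $\lambda_1,\lambda_2$ such that either $\lambda_1\lambda_2\ne0$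 and $\lambda_1/\lambda_2\notin\mathbb Q^+$, or $\lambda_1\neq0=\lambda_2$. Let $\pi:(\tilde X,\mathcal D)\to(\mathbb C^2,p)$ be a fixed reduction process of singularities (Seidenberg) with strict transform $\tilde{\mathcal F}$. A component $D\subset\mathcal D$ is non-dicritical if it is $\tilde{\mathcal F}$-invariant, dicritical otherwise. $\mathrm{Sep}_p(D)$ is the set of separatrices whose strict transform meets $D$; those meeting non-dicritical components are isolated (set $\mathrm{Iso}_p(\mathcal F)$), the others dicritical (set $\mathrm{Dic}_p(\mathcal F)$). If $p$ is already reduced all separatrices are isolated. $\mathrm{Val}(D)$ is the number of other components of $\mathcal D$ meeting $D$. **Balanced divisors.** A divisor of separatrices is a finite formal sum $\sum a_BB$ with $B\in\mathrm{Sep}_p(\mathcal F)$, $a_B\in\mathbb Z$; it decomposes uniquely as $\mathcal B_0-\mathcal B_\infty$ with effective zero and pole divisors without common components, and is reduced if all coefficients of $\mathcal B_0$ and $\mathcal B_\infty$ are $0$ or $1$. It is balanced if $a_B=1$ for all $B\in\mathrm{Iso}_p(\mathcal F)$, $a_B=0$ for all but finitely many $B\in \mathrm{Dic}_p(\mathcal F)$, and for every dicritical component $D$, $\sum_{B\in\mathrm{Sep}_p(D)}a_B=2-\mathrm{Val}(D)$. **GSV-index.** For a reduced $\mathcal F$-invariant curve $C:f=0$ there are $g,h\in\mathbb C[[x,y]]$, each relatively prime to $f$, and a 1-form $\eta$ with $g\omega=h\,df+f\eta$. If $C$ is irreducible, $GSV_p(\mathcal F,C)=i_p(f,h)-i_p(f,g)$.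 In general, $GSV_p$ is determined by the adjunction formula $GSV_p(\mathcal F,C_1\cup C_2)=GSV_p(\mathcal F,C_1)+GSV_p(\mathcal F,C_2)-2i_p(C_1,C_2)$ for invariant curves without common components. (For analytic $C$ this equals $\frac1{2\pi i}\int_{\partial C}\frac gh d\left(\frac hg\right)$.) *)

(* Defs.v *)
From HB Require Import structures.
From mathcomp Require Import all_boot all_order all_algebra.
From mathcomp Require Import complex.
From mathcomp Require Import boolp classical_sets functions cardinality fsbigop.
From mathcomp Require Import reals.

Set Implicit Arguments.
Unset Strict Implicit.
Unset Printing Implicit Defensive.

Import Order.TTheory GRing.Theory Num.Theory.

Local Open Scope classical_set_scope.
Local Open Scope ring_scope.

(** * The ring K[[x,y]] *)

(* [coef f i j] is the coefficient of x^i y^j. A record rather than a bare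
   function type, so that the pointwise product of functions is not inferred. *)
Record fps2 (K : Type) := Fps2 { coef : nat -> nat -> K }.

Lemma fps2P (K : Type) (f g : fps2 K) :
  (forall i j, coef f i j = coef g i j) -> f = g.
Proof.
case: f => f; case: g => g /= e; congr Fps2.
by apply/funext => i; apply/funext => j.
Qed.

HB.instance Definition _ (K : Type) := gen_eqMixin (fps2 K).
HB.instance Definition _ (K : Type) := gen_choiceMixin (fps2 K).

Section Ring.
Variable K : fieldType.
Implicit Types f g h : fps2 K.

Definition fps2_zero : fps2 K := Fps2 (fun _ _ => 0).
Definition fps2_opp f : fps2 K := Fps2 (fun i j => - coef f i j).
Definition fps2_add f g : fps2 K := Fps2 (fun i j => coef f i j + coef g i j).
Definition fps2_one : fps2 K := Fps2 (fun i j => ((i == 0%N) && (j == 0%N))%:R).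
Definition fps2_mul f g : fps2 K :=
  Fps2 (fun i j => \sum_(a < i.+1) \sum_(b < j.+1)
                     coef f a b * coef g (i - a) (j - b)).
Definition fps2_scale (c : K) f : fps2 K := Fps2 (fun i j => c * coef f i j).

Fact fps2_addA : associative fps2_add.
Proof. by move=> f g h; apply: fps2P => i j /=; rewrite addrA. Qed.
Fact fps2_addC : commutative fps2_add.
Proof. by move=> f g; apply: fps2P => i j /=; rewrite addrC. Qed.
Fact fps2_add0 : left_id fps2_zero fps2_add.
Proof. by move=> f; apply: fps2P => i j /=; rewrite add0r. Qed.
Fact fps2_addN : left_inverse fps2_zero fps2_opp fps2_add.
Proof. by move=> f; apply: fps2P => i j /=; rewrite addNr. Qed.

HB.instance Definition _ := GRing.isZmodule.Build (fps2 K)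
  fps2_addA fps2_addC fps2_add0 fps2_addN.

Let trunc (n m : nat) f : {poly {poly K}} :=
  \poly_(i < n.+1) \poly_(j < m.+1) coef f i j.

Let coef_trunc n m f i j : (i <= n)%N -> (j <= m)%N ->
  ((trunc n m f)`_i)`_j = coef f i j.
Proof. by move=> ni mj; rewrite coef_poly ltnS ni coef_poly ltnS mj. Qed.

Let coefM2 (p q : {poly {poly K}}) i j :
  ((p * q)`_i)`_j =
  \sum_(a < i.+1) \sum_(b < j.+1) (p`_a)`_b * (q`_(i - a))`_(j - b).
Proof.
by rewrite coefM coef_sum; apply: eq_bigr => a _; rewrite coefM.
Qed.

Let coef_mul n m f g i j : (i <= n)%N -> (j <= m)%N ->
  coef (fps2_mul f g) i j = ((trunc n m f * trunc n m g)`_i)`_j.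
Proof.
move=> ni mj; rewrite coefM2 /=; apply: eq_bigr => a _; apply: eq_bigr => b _.
have ha : (a <= n)%N by rewrite (leq_trans _ ni) // -ltnS.
have hb : (b <= m)%N by rewrite (leq_trans _ mj) // -ltnS.
by rewrite !coef_trunc // (leq_trans (leq_subr _ _)).
Qed.

Fact fps2_mulC : commutative fps2_mul.
Proof.
move=> f g; apply: fps2P => i j.
by rewrite !(coef_mul _ _ (leqnn i) (leqnn j)) mulrC.
Qed.

Fact fps2_mulA : associative fps2_mul.
Proof.
move=> f g h; apply: fps2P => i j.
have -> : coef (fps2_mul f (fps2_mul g h)) i j =
    ((trunc i j f * (trunc i j g * trunc i j h))`_i)`_j.
  rewrite coefM2; apply: eq_bigr => a _; apply: eq_bigr => b _.
  have ha : (a <= i)%N by rewrite -ltnS.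
  have hb : (b <= j)%N by rewrite -ltnS.
  by rewrite coef_trunc // (@coef_mul i j) // leq_subr.
have -> : coef (fps2_mul (fps2_mul f g) h) i j =
    ((trunc i j f * trunc i j g * trunc i j h)`_i)`_j.
  rewrite [RHS]coefM2; apply: eq_bigr => a _; apply: eq_bigr => b _.
  have ha : (a <= i)%N by rewrite -ltnS.
  have hb : (b <= j)%N by rewrite -ltnS.
  by rewrite (@coef_mul i j) // coef_trunc // leq_subr.
by rewrite mulrA.
Qed.

Fact fps2_mul1 : left_id fps2_one fps2_mul.
Proof.
move=> f; apply: fps2P => i j /=.
rewrite big_ord_recl big_ord_recl /= mul1r !subn0.
rewrite big1 ?addr0 => [|b _]; last by rewrite mul0r.
by rewrite big1 ?addr0 // => a _; rewrite big1 // => b _; rewrite mul0r.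
Qed.

Fact fps2_mulDl : left_distributive fps2_mul +%R.
Proof.
move=> f g h; apply: fps2P => i j /=.
rewrite -big_split /=; apply: eq_bigr => a _.
by rewrite -big_split /=; apply: eq_bigr => b _; rewrite mulrDl.
Qed.

Fact fps2_one_neq0 : fps2_one != 0.
Proof.
apply/eqP => /(congr1 (fun f => coef f 0 0)) /= /eqP.
by rewrite oner_eq0.
Qed.

HB.instance Definition _ := GRing.Zmodule_isComNzRing.Build (fps2 K)
  fps2_mulA fps2_mulC fps2_mul1 fps2_mulDl fps2_one_neq0.

Fact fps2_scaleA (a b : K) f :
  fps2_scale a (fps2_scale b f) = fps2_scale (a * b) f.
Proof. by apply: fps2P => i j /=; rewrite mulrA. Qed.
Fact fps2_scale1 : left_id 1 fps2_scale.
Proof. by move=> f; apply: fps2P => i j /=; rewrite mul1r. Qed.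
Fact fps2_scaleDr : right_distributive fps2_scale +%R.
Proof. by move=> a f g; apply: fps2P => i j /=; rewrite mulrDr. Qed.
Fact fps2_scaleDl f : {morph fps2_scale^~ f : a b / a + b}.
Proof. by move=> a b; apply: fps2P => i j /=; rewrite mulrDl. Qed.

HB.instance Definition _ := GRing.Zmodule_isLmodule.Build K (fps2 K)
  fps2_scaleA fps2_scale1 fps2_scaleDr fps2_scaleDl.

Definition fps2_unit : {pred fps2 K} := fun f => `[< exists g, g * f = 1 >].
Definition fps2_inv f : fps2 K :=
  if pselect (exists g, g * f = 1) is left e then projT1 (cid e) else f.

Fact fps2_mulVr : {in fps2_unit, left_inverse 1 fps2_inv *%R}.
Proof.
move=> f /asboolP ef; rewrite /fps2_inv; case: pselect => // e.
exact: (projT2 (cid e)).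
Qed.
Fact fps2_unitP f g : g * f = 1 -> fps2_unit f.
Proof. by move=> e; apply/asboolP; exists g. Qed.
Fact fps2_inv_out : {in [predC fps2_unit], fps2_inv =1 id}.
Proof.
by move=> f /asboolPn nef; rewrite /fps2_inv; case: pselect.
Qed.

HB.instance Definition _ := GRing.ComNzRing_hasMulInverse.Build (fps2 K)
  fps2_mulVr fps2_unitP fps2_inv_out.

End Ring.

Section Foliations.
Variable K : fieldType.
Local Notation S := (fps2 K).
Implicit Types (f g h : S).

Definition fX : S := Fps2 (fun i j => ((i == 1%N) && (j == 0%N))%:R).
Definition fY : S := Fps2 (fun i j => ((i == 0%N) && (j == 1%N))%:R).
Definition fC (c : K) : S := c *: (1 : S).

Definition dx f : S := Fps2 (fun i j => coef f i.+1 j *+ i.+1).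
Definition dy f : S := Fps2 (fun i j => coef f i j.+1 *+ j.+1).

Definition divides f g : Prop := exists q, g = q * f.
Definition rel_prime f g : Prop :=
  forall d, divides d f -> divides d g -> d \is a GRing.unit.
Definition irreducible f : Prop :=
  [/\ f != 0, f \isn't a GRing.unit &
      forall g h, f = g * h -> g \is a GRing.unit \/ h \is a GRing.unit].

(** * Curves *)

(* The irreducible curve f = 0 is encoded as the set of all its equations. *)
Definition branch := set S.
Definition curve_of f : branch :=
  [set g | exists2 u, u \is a GRing.unit & g = u * f].

Definition reduced_curve f : Prop :=
  [/\ f != 0, coef f 0 0 = 0 &
      forall g, divides (g ^+ 2) f -> g \is a GRing.unit].

Definition components f : set branch :=
  [set B | exists g, [/\ irreducible g, divides g f & B = curve_of g]].

(* The n elements b form a basis of the vector space K[[x,y]] / (g, h). *)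
Definition has_intersection_number g h (n : nat) : Prop :=
  exists b : 'I_n -> S, forall u, exists! c : {ffun 'I_n -> K},
    exists r s, u = \sum_i c i *: b i + (r * g + s * h).

(* Equal to 0 by convention when the quotient is infinite-dimensional. *)
Definition intersection_number g h : nat :=
  xget 0%N [set n | has_intersection_number g h n].

Definition milnor f : nat := intersection_number (dx f) (dy f).

Definition has_multiplicity f (n : nat) : Prop :=
  (exists i j, (i + j)%N = n /\ coef f i j != 0) /\
  (forall i j, (i + j < n)%N -> coef f i j = 0).
Definition multiplicity f : nat := xget 0%N [set n | has_multiplicity f n].

(** * Foliations *)

(* The pair (P, Q) stands for the 1-form P dx + Q dy. *)
Definition oneform := (S * S)%type.

Definition singular (w : oneform) : Prop :=
  coef w.1 0 0 = 0 /\ coef w.2 0 0 = 0.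

Record foliation := Foliation {
  form :> oneform;
  form_prime : rel_prime form.1 form.2;
  form_singular : singular form }.

Definition invariant_curve (w : oneform) f : Prop :=
  exists k, w.1 * dy f - w.2 * dx f = f * k.

(* Linear part at the origin of the dual vector field - Q d/dx + P d/dy. *)
Definition linear_part (w : oneform) : 'M[K]_2 :=
  \matrix_(i < 2, j < 2)
    nth 0 (nth [::] [:: [:: - coef w.2 1 0; - coef w.2 0 1];
                        [:: coef w.1 1 0; coef w.1 0 1]] i) j.

Definition reduced_singularity (w : oneform) : Prop :=
  singular w /\ linear_part w != 0 /\
  exists l1 l2 : K,
    char_poly (linear_part w) = ('X - l1%:P) * ('X - l2%:P) /\
    ((l1 * l2 != 0 /\ forall q : rat, 0 < q -> l1 / l2 != ratr q) \/
     (l1 != 0 /\ l2 = 0)).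

(** * Blow-ups and infinitely near points *)

(* The projective line over K: [Some t] is (1 : t) and [None] is (0 : 1). *)
Definition P1 := option K.
Definition hcoord (c : P1) : K * K := if c is Some t then (1, t) else (0, 1).

(* Pull-back of a series to the point c of the exceptional line of the blow-up
   of the origin: f(x, x (y + t)) at c = (1 : t), f(x y, y) at c = (0 : 1).
   The exceptional line is x = 0 in the first chart, y = 0 in the second. *)
Definition pullback (c : P1) f : S :=
  match c with
  | Some t => Fps2 (fun n m =>
      \sum_(j < n.+1) coef f (n - j) j * t ^+ (j - m) *+ 'C(j, m))
  | None => Fps2 (fun n m => if (n <= m)%N then coef f n (m - n) else 0)
  end.

Definition exceptional (c : P1) : S := if c is Some _ then fX else fY.

Definition pullback_form (c : P1) (w : oneform) : oneform :=
  let P := pullback c w.1 in let Q := pullback c w.2 in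
  match c with
  | Some t => (P + (fY + fC t) * Q, fX * Q)
  | None => (fY * P, fX * P + Q)
  end.

(* Strict transforms: divide by the largest power of the exceptional line. *)
Definition strict1 (c : P1) f : S :=
  xget 0 [set g | ~ divides (exceptional c) g /\
                  exists m, pullback c f = exceptional c ^+ m * g].
Definition strict_form1 (c : P1) (w : oneform) : oneform :=
  xget (0, 0)
    [set w' | ~ (divides (exceptional c) w'.1 /\ divides (exceptional c) w'.2) /\
              exists m, [/\ (pullback_form c w).1 = exceptional c ^+ m * w'.1 &
                            (pullback_form c w).2 = exceptional c ^+ m * w'.2]].

(* A point infinitely near to p, or p itself, is the list of the successive
   directions leading to it, most recent first: c :: v is the point c of the
   exceptional line created by blowing up v. *)
Definition ipoint := seq P1.

Fixpoint strict (q : ipoint) f : S :=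
  if q is c :: v then strict1 c (strict v f) else f.
Fixpoint strict_form (q : ipoint) (w : oneform) : oneform :=
  if q is c :: v then strict_form1 c (strict_form v w) else w.

(* An exceptional component is named by the point v whose blow-up creates it.
   [axes q] gives the names of the components having local equation x = 0,
   respectively y = 0, at q: the strict transform of x = 0 passes through the
   point (0 : 1) of the new line, that of y = 0 through (1 : 0). *)
Fixpoint axes (q : ipoint) : option ipoint * option ipoint :=
  match q with
  | [::] => (None, None)
  | Some t :: v => (Some v, if t == 0 then (axes v).2 else None)
  | None :: v => ((axes v).1, Some v)
  end.

Definition local_equation (v q : ipoint) f : Prop :=
  ((axes q).1 = Some v /\ f = fX) \/ ((axes q).2 = Some v /\ f = fY).

(* A finite composition of point blow-ups over p is given by the list T of
   the points that are blown up. *)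
Definition blowup_sequence (T : seq ipoint) : Prop :=
  forall c v, c :: v \in T -> v \in T.

(* The points over p of the surface obtained by blowing up T. *)
Definition surface_point (T : seq ipoint) (q : ipoint) : Prop :=
  q \notin T /\ (q = [::] \/ behead q \in T).

Definition reduction (F : foliation) (T : seq ipoint) : Prop :=
  blowup_sequence T /\
  forall q, surface_point T q -> singular (strict_form q F) ->
    reduced_singularity (strict_form q F).

Definition meet_components (T : seq ipoint) (v v' : ipoint) : Prop :=
  exists q, surface_point T q /\
    (exists f, local_equation v q f) /\ (exists f, local_equation v' q f).

Definition valence (T : seq ipoint) (v : ipoint) : nat :=
  count (fun v' => (v' != v) && `[< meet_components T v v' >]) (undup T).

Definition nondicritical (F : foliation) (T : seq ipoint) (v : ipoint) : Prop :=
  forall q f, surface_point T q -> local_equation v q f ->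
    invariant_curve (strict_form q F) f.

(** * Separatrices and balanced divisors *)

Definition Sep (F : foliation) : set branch :=
  [set B | exists f, [/\ irreducible f, invariant_curve F f & B = curve_of f]].

(* The separatrices whose strict transform meets the component v. *)
Definition SepD (F : foliation) (T : seq ipoint) (v : ipoint) : set branch :=
  [set B | Sep F B /\ exists f q, [/\ B f, surface_point T q,
     exists g, local_equation v q g & coef (strict q f) 0 0 = 0]].

Definition Iso (F : foliation) (T : seq ipoint) : set branch :=
  [set B | Sep F B /\
     (reduced_singularity F \/
      exists v, [/\ v \in T, nondicritical F T v & SepD F T v B])].
Definition Dic (F : foliation) (T : seq ipoint) : set branch :=
  Sep F `\` Iso F T.

Record divisor (F : foliation) := Divisor {
  mult :> branch -> int;
  mult_Sep : forall B, mult B != 0 -> Sep F B;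
  mult_finite : finite_set [set B | mult B != 0] }.

Definition zero_part (F : foliation) (a : divisor F) (B : branch) : int :=
  Num.max (a B) 0.
Definition pole_part (F : foliation) (a : divisor F) (B : branch) : int :=
  Num.max (- a B) 0.

Definition reduced_divisor (F : foliation) (a : divisor F) : Prop :=
  forall B, (zero_part a B = 0 \/ zero_part a B = 1) /\
            (pole_part a B = 0 \/ pole_part a B = 1).

Definition balanced (F : foliation) (T : seq ipoint) (a : divisor F) : Prop :=
  [/\ forall B, Iso F T B -> a B = 1,
      finite_set [set B | Dic F T B /\ a B != 0] &
      forall v, v \in T -> ~ nondicritical F T v ->
        \sum_(B \in SepD F T v) a B = 2 - (valence T v)%:Z].

(* f = 0 is the reduced curve identified with the zero divisor of a. *)
Definition zero_curve (F : foliation) (a : divisor F) f : Prop :=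
  reduced_curve f /\ components f = [set B | zero_part a B = 1].

(** * The GSV-index and the polar curves *)

Definition GSV_decomposition (w : oneform) f g h (eta : oneform) : Prop :=
  g * w.1 = h * dx f + f * eta.1 /\ g * w.2 = h * dy f + f * eta.2.

Inductive is_GSV (w : oneform) : S -> int -> Prop :=
| is_GSV_irreducible f g h eta :
    irreducible f -> invariant_curve w f -> rel_prime g f -> rel_prime h f ->
    GSV_decomposition w f g h eta ->
    is_GSV w f ((intersection_number f h)%:Z - (intersection_number f g)%:Z)
| is_GSV_union f1 f2 n1 n2 :
    reduced_curve f1 -> reduced_curve f2 ->
    invariant_curve w f1 -> invariant_curve w f2 -> rel_prime f1 f2 ->
    is_GSV w f1 n1 -> is_GSV w f2 n2 ->
    is_GSV w (f1 * f2) (n1 + n2 - 2 * (intersection_number f1 f2)%:Z).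

Definition GSV (w : oneform) f : int := xget 0 [set n | is_GSV w f n].

Definition polar (w : oneform) (c : P1) : S :=
  (hcoord c).1 *: w.1 + (hcoord c).2 *: w.2.

Definition generically (A : set P1) : Prop := cofinite_set A.

End Foliations.

(* Main.v *)
(* Write w = P dx + Q dy.  Along an irreducible component of f = 0 a GSV
   decomposition says that w is (h/g) df, so i(f,h) - i(f,g) equals
   i(f, aP + bQ) - i(f, a dx f + b dy f) for every direction (a : b) in which both
   numbers are finite.  The right-hand side obeys the adjunction formula, hence
   computes the GSV-index of every reduced invariant curve, and it remains to
   see that i(f, a dx f + b dy f) = mu + nu - 1 for generic (a : b).

   After a shear the direction is d/dy.  A Puiseux branch y = a(x^(1/N)) of
   dy f = 0 satisfies (d/dx) f(x, a) = dx f(x, a), so f and x dx f vanish to the same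
   order along it; summing over the branches, i(dy f, f) = i(dy f, x dx f), which is
   i(dy f, dx f) + (nu - 1) when dy f has order nu - 1 on the line x = 0. *)
From HB Require Import structures.
Require Import Defs.
From mathcomp Require Import all_boot all_order all_algebra.
From mathcomp Require Import complex boolp classical_sets functions cardinality.
From mathcomp Require Import reals zify ring.

Set Implicit Arguments.
Unset Strict Implicit.
Unset Printing Implicit Defensive.

Import Order.TTheory GRing.Theory Num.Theory.

Local Open Scope classical_set_scope.
Local Open Scope ring_scope.

(** Two conventions shape the proof. [intersection_number] is 0 on an infinite-dimensional quotient,
    so additivity is available only with a finiteness proof, carried by [finite2]: the ideal
    contains a power of each coordinate. And [GSV] picks a value of the relation [is_GSV], so the
    formula is proved for every value of that relation, and a value is shown to exist.

    Orders along a Puiseux branch are not taken in a field of Puiseux series. Substituting x^N for x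
    makes dy f split into factors y - a(x) inside the same ring and multiplies every finite
    intersection number by N, which cancels. Roots are found by induction on the order in y. The
    obstacle is a Newton polygon edge whose polynomial has a single root, since the order would then
    not drop; it is excluded by first removing the coefficient next to the leading one, which works
    in characteristic zero.

    Generic means a cofinite set of directions. The finitely many bad ones, where a polar contains a
    component of the curve or the direction is tangent to it, are discarded as they occur. *)

Section PowerSeries.
Variable K : fieldType.
Local Notation S := (fps2 K).
Local Notation X := (fX K).
Local Notation Y := (fY K).
Implicit Types (f g h u : S) (c : K).

(** * Coefficients and the algebra structure of K[[x,y]] *)

Lemma fcoefD f g i j : coef (f + g) i j = coef f i j + coef g i j.
Proof. by []. Qed.
Lemma fcoefN f i j : coef (- f) i j = - coef f i j.
Proof. by []. Qed.
Lemma fcoefB f g i j : coef (f - g) i j = coef f i j - coef g i j.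
Proof. by []. Qed.
Lemma fcoef0 i j : coef (0 : S) i j = 0.
Proof. by []. Qed.
Lemma fcoef1 i j : coef (1 : S) i j = ((i == 0%N) && (j == 0%N))%:R.
Proof. by []. Qed.
Lemma fcoefZ c f i j : coef (c *: f) i j = c * coef f i j.
Proof. by []. Qed.
Lemma fcoefMxy f g i j : coef (f * g) i j =
  \sum_(a < i.+1) \sum_(b < j.+1) coef f a b * coef g (i - a) (j - b).
Proof. by []. Qed.
Lemma fcoef_sum (I : Type) (r : seq I) (P : pred I) (F : I -> S) i j :
  coef (\sum_(k <- r | P k) F k) i j = \sum_(k <- r | P k) coef (F k) i j.
Proof. by apply: (big_morph (fun f : S => coef f i j)). Qed.

Lemma scale_fpsE c f : c *: f = fC c * f.
Proof.
apply: fps2P => i j; rewrite fcoefMxy big_ord_recl big_ord_recl /= !subn0 mulr1.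
rewrite big1 ?addr0 => [|b _]; last by rewrite mulr0 mul0r.
by rewrite big1 ?addr0 // => a _; rewrite big1 // => b _; rewrite mulr0 mul0r.
Qed.

Lemma fps_scaleAl c f g : c *: (f * g) = c *: f * g.
Proof. by rewrite !scale_fpsE mulrA. Qed.

HB.instance Definition _ := GRing.Lmodule_isLalgebra.Build K S fps_scaleAl.

Lemma fps_scaleAr c f g : c *: (f * g) = f * (c *: g).
Proof. by rewrite mulrC fps_scaleAl mulrC. Qed.

HB.instance Definition _ := GRing.Lalgebra_isAlgebra.Build K S fps_scaleAr.

Lemma fcoefXM f i j : coef (X * f) i j = if i is k.+1 then coef f k j else 0.
Proof.
rewrite fcoefMxy; case: i => [|i].
  by rewrite big_ord1 big1 // => b _; rewrite /= mul0r.
rewrite big_ord_recl big1 ?add0r => [|b _]; last by rewrite /= mul0r.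
rewrite big_ord_recl big_ord_recl /= mul1r subSS !subn0.
rewrite big1 ?addr0 => [|b _]; last by rewrite mul0r.
by rewrite big1 ?addr0 // => a _; rewrite big1 // => b _; rewrite mul0r.
Qed.

Lemma fcoefYM f i j : coef (Y * f) i j = if j is k.+1 then coef f i k else 0.
Proof.
rewrite fcoefMxy exchange_big /=; case: j => [|j].
  by rewrite big_ord1 big1 // => b _; rewrite andbF mul0r.
rewrite big_ord_recl big1 ?add0r => [|b _]; last by rewrite andbF mul0r.
rewrite big_ord_recl big_ord_recl /= mul1r subSS !subn0.
rewrite big1 ?addr0 => [|b _]; last by rewrite mul0r.
by rewrite big1 ?addr0 // => a _; rewrite big1 // => b _; rewrite andbF mul0r.
Qed.

Lemma fcoefXnM n f i j :
  coef (X ^+ n * f) i j = if (n <= i)%N then coef f (i - n) j else 0.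
Proof.
elim: n i => [|n IH] i; first by rewrite mul1r subn0.
by rewrite exprS -mulrA fcoefXM; case: i => [|i] //; rewrite IH subSS.
Qed.

Lemma fcoefYnM n f i j :
  coef (Y ^+ n * f) i j = if (n <= j)%N then coef f i (j - n) else 0.
Proof.
elim: n j => [|n IH] j; first by rewrite mul1r subn0.
by rewrite exprS -mulrA fcoefYM; case: j => [|j] //; rewrite IH subSS.
Qed.

Lemma fcoefXn n i j : coef (X ^+ n) i j = ((i == n) && (j == 0%N))%:R.
Proof.
rewrite -[X ^+ n]mulr1 fcoefXnM fcoef1; case: leqP => ni; last first.
  by rewrite ltn_eqF.
by rewrite subn_eq0 [(i == n)%N]eqn_leq ni andbT.
Qed.

Lemma fcoef_monom k l i j :
  coef (X ^+ k * Y ^+ l) i j = ((i == k) && (j == l))%:R.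
Proof.
rewrite fcoefXnM -[Y ^+ l]mulr1; case: leqP => ki; last by rewrite ltn_eqF.
rewrite fcoefYnM fcoef1; case: leqP => lj; last by rewrite (ltn_eqF lj) andbF.
by rewrite !subn_eq0 !eqn_leq ki lj !andbT.
Qed.

Lemma fcoef00M f g : coef (f * g) 0 0 = coef f 0 0 * coef g 0 0.
Proof. by rewrite fcoefMxy !big_ord1. Qed.

Lemma divXnP n f :
  (forall i j, (i < n)%N -> coef f i j = 0) -> exists g, f = X ^+ n * g.
Proof.
move=> f0; exists (Fps2 (fun i j => coef f (i + n) j)).
apply: fps2P => i j; rewrite fcoefXnM; case: leqP => ni /=; last by rewrite f0.
by rewrite subnK.
Qed.

Lemma fps2_neq0 f : f != 0 -> exists i j, coef f i j != 0.
Proof.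
move=> f0; apply: contrapT => H; case/eqP: f0; apply: fps2P => i j.
by apply/eqP; apply: contrapT => /negP nz; apply: H; exists i, j.
Qed.

(** * Regularity in y and Weierstrass division *)

(** The restriction of f to the line x = 0 has order n, as in the Weierstrass theorems. *)
Definition yregular f (n : nat) : Prop :=
  coef f 0 n != 0 /\ forall j, (j < n)%N -> coef f 0 j = 0.

(** Removing the largest power of x leaves a series that does not vanish identically on x = 0. *)
Lemma yregular_Xn f : f != 0 ->
  exists k n g, f = X ^+ k * g /\ yregular g n.
Proof.
move=> /fps2_neq0 ex0.
have exk : exists k, `[< exists j, coef f k j != 0 >].
  by have [i ex] := ex0; exists i; apply/asboolP.
case: (ex_minnP exk) => k /asboolP exj kmin.
have [|g fE] := @divXnP k f.
  move=> i j ik; apply/eqP; apply: contrapT => /negP nz.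
  by have := kmin i; rewrite leqNgt ik => H; apply: notF (H _); apply/asboolP; exists j.
have gE j : coef g 0 j = coef f k j by rewrite fE fcoefXnM leqnn subnn.
case: (ex_minnP exj) => n fn nmin; exists k, n, g; split=> //; split.
  by rewrite gE.
move=> j jn; rewrite gE; apply/eqP; apply: contrapT => /negP nz.
by have := nmin j nz; rewrite leqNgt jn.
Qed.

Lemma yregularM f g n m :
  yregular f n -> yregular g m -> yregular (f * g) (n + m).
Proof.
move=> [fn f0] [gm g0].
have E j : coef (f * g) 0 j = \sum_(b < j.+1) coef f 0 b * coef g 0 (j - b).
  by rewrite fcoefMxy big_ord1.
split=> [|j jnm].
  have nnm : (n < (n + m).+1)%N by rewrite ltnS leq_addr.
  rewrite E (bigD1 (Ordinal nnm)) //= addKn big1 ?addr0 ?mulf_neq0 // => b bn.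
  case: (ltngtP b n) => bn'; first by rewrite f0 ?mul0r.
    by rewrite g0 ?mulr0 //; have := ltn_ord b; lia.
  by case/eqP: bn; apply/val_inj.
rewrite E big1 // => b _.
case: (ltnP b n) => bn'; first by rewrite f0 ?mul0r.
by rewrite g0 ?mulr0 //; have := ltn_ord b; lia.
Qed.

(** Two non-zero series have leading monomials by [yregular_Xn], and their product survives in
    bidegree [(k + l, n + m)]. *)
Lemma fps2_idomain : GRing.integral_domain_axiom S.
Proof.
move=> f g fg0; apply/norP => -[/yregular_Xn [k [n [f1 [fE f1n]]]]].
move=> /yregular_Xn [l [m [g1 [gE g1m]]]].
have [] := yregularM f1n g1m.
have /(congr1 (fun h => coef h (k + l) (n + m))) := fg0.
rewrite fE gE mulrACA -exprD fcoefXnM leqnn subnn fcoef0 => ->.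
by rewrite eqxx.
Qed.

HB.instance Definition _ := GRing.ComUnitRing_isIntegral.Build S fps2_idomain.

Section FixedPoint.
Variable wt : nat -> nat -> nat.
Let agree n f g := forall i j, (wt i j < n)%N -> coef f i j = coef g i j.

(** Banach's fixed point theorem: each iteration gains one unit of weight, so a coefficient of
    weight w is stationary from iterate w + 1 on and the limit is read off there. *)
Lemma contraction_fixpoint (Phi : S -> S) :
  (forall n f g, agree n f g -> agree n.+1 (Phi f) (Phi g)) ->
  exists f, Phi f = f.
Proof.
move=> ctr; pose it n := iter n Phi 0.
have itP n m : agree n (it n) (it (n + m)%N).
  by elim: n => [|n IH] //; rewrite addSn; apply: ctr.
pose f := Fps2 (fun i j => coef (it (wt i j).+1) i j).
have fP n : agree n f (it n).
  move=> i j ijn /=.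
  by have := itP (wt i j).+1 (n - (wt i j).+1)%N i j (ltnSn _); rewrite subnKC.
exists f; apply: fps2P => i j.
have := ctr _ _ _ (fP (wt i j)) i j (ltnSn _) => ->.
by rewrite [RHS](fP (wt i j).+1).
Qed.
End FixedPoint.

(* With weight n+1 on x and 1 on y, the leading term c Y^n of d is the part of
   lowest weight, so that solving for the quotient is a contraction. *)
Lemma weierstrass_division d n : yregular d n ->
  forall e, exists q r, e = q * d + r /\
    forall i j, (n <= j)%N -> coef r i j = 0.
Proof.
move=> [dn d0] e; pose c := coef d 0 n.
pose hi f : S := Fps2 (fun i j => coef f i (n + j)).
pose d' := d - c *: Y ^+ n.
(* Since [hi (q * Y ^+ n) = q], the condition [hi (e - q * d) = 0], which bounds the degree in y of
   the remainder, is the fixed-point equation of [Phi]. *)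
pose Phi q := c^-1 *: (hi e - hi (q * d')).
have d'0 j : (j <= n)%N -> coef d' 0 j = 0.
  move=> jn; rewrite fcoefB fcoefZ -[Y ^+ n]mul1r -(expr0 X) fcoef_monom /=.
  case: (ltngtP j n) jn => // [jn _|-> _]; last by rewrite mulr1 subrr.
  by rewrite d0 // mulr0 subrr.
have [|q qE] := @contraction_fixpoint (fun i j => n.+1 * i + j)%N Phi.
  move=> k f g fg i j ijk; rewrite /Phi !fcoefZ !fcoefB; congr (_ * (_ - _)).
  change (coef (f * d') i (n + j) = coef (g * d') i (n + j)).
  rewrite (mulrC f) (mulrC g) !fcoefMxy.
  apply: eq_bigr => a _; apply: eq_bigr => b _.
  have [ab|] := boolP ((a == 0%N :> nat) && (b <= n)%N).
    by case/andP: ab => /eqP -> bn; rewrite d'0 // !mul0r.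
  move=> nab; congr (_ * _); apply: fg.
  have := ltn_ord a; have := ltn_ord b; rewrite !ltnS => bj ai.
  have [a0|a0] := posnP a; first by rewrite a0 /= -ltnNge in nab; lia.
  have : (n.+1 * a >= n.+1)%N by rewrite leq_pmulr.
  have : (n.+1 * a <= n.+1 * i)%N by rewrite leq_mul2l ai orbT.
  by rewrite mulnBr; lia.
exists q, (e - q * d); split=> [|i j nj]; first by rewrite addrC subrK.
have -> : d = d' + c *: Y ^+ n by rewrite /d' subrK.
rewrite mulrDr -fps_scaleAr (mulrC q (Y ^+ n)) fcoefB fcoefD fcoefZ fcoefYnM nj.
have := congr1 (fun h => c * coef h i (j - n)) qE.
rewrite /Phi fcoefZ mulVKf // fcoefB => <-.
have hiE f : coef (hi f) i (j - n) = coef f i j by rewrite /= subnKC.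
by rewrite !hiE addrCA subrr addr0 subrr.
Qed.

(** A series with non-zero constant term is regular of order 0, so dividing 1 by it leaves no
    remainder. *)
Lemma fps_unitE f : (f \is a GRing.unit) = (coef f 0 0 != 0).
Proof.
apply/idP/idP => [fu|f0].
  apply/eqP => f0; have /(congr1 (fun h => coef h 0 0)) := mulrV fu.
  by rewrite fcoef00M f0 mul0r fcoef1 => /eqP; rewrite eq_sym oner_eq0.
have [|q [r [E r0]]] := @weierstrass_division f 0 _ 1; first by split.
apply/unitrPr; exists q; rewrite E [r](_ : _ = 0) ?addr0 1?mulrC //.
by apply: fps2P => i j; rewrite r0.
Qed.

Lemma X_neq0 : X != 0.
Proof.
by apply/eqP => /(congr1 (fun h => coef h 1 0)) /eqP; rewrite /= oner_eq0.
Qed.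

Lemma nonunitE f : (f \isn't a GRing.unit) = (coef f 0 0 == 0).
Proof. by rewrite fps_unitE negbK. Qed.

(** * The m-adic topology and substitution *)

(** The N-th power of the maximal ideal (x, y). *)
Definition inmx (N : nat) f : Prop :=
  forall i j, (i + j < N)%N -> coef f i j = 0.

Lemma inmx0 N : inmx N 0. Proof. by []. Qed.
Lemma inmxD N f g : inmx N f -> inmx N g -> inmx N (f + g).
Proof. by move=> f0 g0 i j ij; rewrite fcoefD f0 ?g0 ?addr0. Qed.
Lemma inmxN N f : inmx N f -> inmx N (- f).
Proof. by move=> f0 i j ij; rewrite fcoefN f0 ?oppr0. Qed.
Lemma inmxB N f g : inmx N f -> inmx N g -> inmx N (f - g).
Proof. by move=> f0 g0; apply/inmxD/inmxN. Qed.
Lemma inmxZ N c f : inmx N f -> inmx N (c *: f).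
Proof. by move=> f0 i j ij; rewrite fcoefZ f0 ?mulr0. Qed.
Lemma inmxM N M f g : inmx N f -> inmx M g -> inmx (N + M) (f * g).
Proof.
move=> f0 g0 i j ij; rewrite fcoefMxy big1 // => a _; rewrite big1 // => b _.
have := ltn_ord a; have := ltn_ord b; rewrite !ltnS => bj ai.
case: (ltnP (a + b) N) => abN; first by rewrite f0 ?mul0r.
by rewrite g0 ?mulr0 //; lia.
Qed.
Lemma inmxW N M f : (M <= N)%N -> inmx N f -> inmx M f.
Proof. by move=> MN f0 i j ij; apply: f0; apply: leq_trans MN. Qed.
Lemma inmxMl N f g : inmx N g -> inmx N (f * g).
Proof. by move=> g0; rewrite -[N]add0n; apply: inmxM. Qed.
Lemma inmxMr N f g : inmx N f -> inmx N (f * g).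
Proof. by move=> f0; rewrite mulrC; apply: inmxMl. Qed.
Lemma inmx1E f : inmx 1 f <-> coef f 0 0 = 0.
Proof. by split=> [->//|f0 [|i] [|j]]. Qed.
Lemma inmxX N f : inmx 1 f -> inmx N (f ^+ N).
Proof. by move=> f0; elim: N => [|N IH] //; rewrite exprS -add1n; apply: inmxM. Qed.

Lemma inmx_eq f g : (forall N, inmx N (f - g)) -> f = g.
Proof.
move=> fg; apply: fps2P => i j.
by have /eqP := fg (i + j).+1 i j (ltnSn _); rewrite fcoefB subr_eq0 => /eqP.
Qed.

Lemma trunc_fps N f :
  inmx N (f - \sum_(k < N) \sum_(l < N) coef f k l *: (X ^+ k * Y ^+ l)).
Proof.
move=> i j ij; apply/eqP; rewrite fcoefB subr_eq0 fcoef_sum eq_sym; apply/eqP.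
have iN : (i < N)%N by lia.
have jN : (j < N)%N by lia.
rewrite (bigD1 (Ordinal iN)) // -[LHS]/(_ + _) [X in _ + X]big1 => [|k ki]; last first.
  rewrite fcoef_sum big1 // => l _; rewrite fcoefZ fcoef_monom.
  case: eqP => [ik|]; last by rewrite mulr0.
  by case/eqP: ki; apply/val_inj.
rewrite addr0 fcoef_sum (bigD1 (Ordinal jN)) // -[LHS]/(_ + _) big1 => [|l lj].
  by rewrite fcoefZ fcoef_monom !eqxx mulr1 addr0.
rewrite fcoefZ fcoef_monom; case: (_ =P l :> nat) => [il|]; last first.
  by rewrite andbF mulr0.
by case/eqP: lj; apply/val_inj.
Qed.

(** Induction for linear, m-adically closed properties: 1 and multiplication by x and y give the
    polynomials, and the last premise passes to the limit. Identities for substitutions and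
    derivations are reduced to these cases without handling double sums. *)
Lemma fps2_ind (P : S -> Prop) :
  P 1 -> (forall f, P f -> P (X * f)) -> (forall f, P f -> P (Y * f)) ->
  (forall c f g, P f -> P g -> P (c *: f + g)) ->
  (forall f, (forall N, exists e g : S, [/\ f = e + g, P g & inmx N e]) -> P f) ->
  forall f, P f.
Proof.
move=> P1 PX PY PD Plim f; apply: Plim => N.
have P0 : P 0 by have := PD (-1) _ _ P1 P1; rewrite scaleN1r addNr.
have PZ c g : P g -> P (c *: g) by rewrite -[c *: g]addr0 => Pg; apply: PD.
have PA g h : P g -> P h -> P (g + h).
  by move=> Pg Ph; rewrite -[g]scale1r; apply: PD.
pose t := \sum_(k < N) \sum_(l < N) coef f k l *: (X ^+ k * Y ^+ l).
exists (f - t), t; split; first by rewrite subrK.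
  apply: big_ind => // k _; apply: big_ind => // l _; apply: PZ.
  elim: (nat_of_ord k) => [|k' IH]; last by rewrite exprS -mulrA; apply: PX.
  rewrite mul1r.
  by elim: (nat_of_ord l) => [|l' IH] //; rewrite exprS; apply: PY.
exact: trunc_fps.
Qed.

Section Comp.
Variables a b : S.

Let ev N M f : S := \sum_(k < N) \sum_(l < M) coef f k l *: (a ^+ k * b ^+ l).

(* f(a, b); meaningful only when a and b have no constant term. *)
Definition fcomp f : S := Fps2 (fun i j => coef (ev (i + j).+1 (i + j).+1 f) i j).

Lemma fcomp_is_linear : linear fcomp.
Proof.
move=> c f g; apply: fps2P => i j /=; rewrite !fcoef_sum mulr_sumr -big_split /=.
apply: eq_bigr => k _; rewrite !fcoef_sum mulr_sumr -big_split /=.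
by apply: eq_bigr => l _; rewrite mulrDl mulrA.
Qed.
HB.instance Definition _ := GRing.isLinear.Build K S S *:%R fcomp fcomp_is_linear.

Hypothesis a0 : inmx 1 a.
Hypothesis b0 : inmx 1 b.

Let abN k l : inmx (k + l) (a ^+ k * b ^+ l).
Proof. by apply: inmxM; apply: inmxX. Qed.

(** [a ^+ k * b ^+ l] has order at least k + l, so raising the truncation bounds does not change the
    coefficient. *)
Let fcomp_ev N M f i j : (i + j < N)%N -> (i + j < M)%N ->
  coef (fcomp f) i j = coef (ev N M f) i j.
Proof.
move=> ijN ijM /=; rewrite !fcoef_sum.
rewrite (big_ord_widen N
  (fun k => coef (\sum_(l < (i + j).+1) coef f k l *: (a ^+ k * b ^+ l)) i j)) //.
rewrite big_mkcond; apply: eq_bigr => k _; rewrite !fcoef_sum.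
case: ltnP => ik; last first.
  by rewrite big1 // => l _; rewrite fcoefZ abN ?mulr0 //; lia.
rewrite (big_ord_widen M
  (fun l => coef (coef f k l *: (a ^+ k * b ^+ l)) i j)) //.
rewrite big_mkcond; apply: eq_bigr => l _; case: ltnP => // il.
by rewrite fcoefZ abN ?mulr0 //; lia.
Qed.

Lemma fcomp_inmx N f : inmx N f -> inmx N (fcomp f).
Proof.
move=> f0 i j ij; rewrite /= fcoef_sum big1 // => k _.
rewrite fcoef_sum big1 // => l _; rewrite fcoefZ.
case: (ltnP (k + l) N) => kl; first by rewrite f0 ?mul0r.
by rewrite abN ?mulr0 //; lia.
Qed.

Let fcompXM f : fcomp (X * f) = a * fcomp f.
Proof.
apply: inmx_eq => N i j ij; apply/eqP; rewrite fcoefB subr_eq0; apply/eqP.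
rewrite (@fcomp_ev N.+1 N) //; last exact: ltnW.
have -> : ev N.+1 N (X * f) = a * ev N N f.
  rewrite /ev big_ord_recl big1 ?add0r => [|l _]; last first.
    by rewrite fcoefXM scale0r.
  rewrite mulr_sumr; apply: eq_bigr => k _; rewrite mulr_sumr.
  by apply: eq_bigr => l _; rewrite fcoefXM exprS -mulrA -fps_scaleAr.
have /(_ i j ij) : inmx N (a * (ev N N f - fcomp f)).
  apply: inmxMl => i' j' ij'; apply/eqP; rewrite fcoefB subr_eq0 eq_sym.
  by apply/eqP/fcomp_ev.
by rewrite mulrBr fcoefB => /eqP; rewrite subr_eq0 => /eqP.
Qed.

Let fcompYM f : fcomp (Y * f) = b * fcomp f.
Proof.
apply: inmx_eq => N i j ij; apply/eqP; rewrite fcoefB subr_eq0; apply/eqP.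
rewrite (@fcomp_ev N N.+1) //; last exact: ltnW.
have -> : ev N N.+1 (Y * f) = b * ev N N f.
  rewrite /ev mulr_sumr; apply: eq_bigr => k _; rewrite mulr_sumr.
  rewrite big_ord_recl fcoefYM scale0r add0r; apply: eq_bigr => l _.
  by rewrite fcoefYM exprS -fps_scaleAr; congr (_ *: _); rewrite mulrCA.
have /(_ i j ij) : inmx N (b * (ev N N f - fcomp f)).
  apply: inmxMl => i' j' ij'; apply/eqP; rewrite fcoefB subr_eq0 eq_sym.
  by apply/eqP/fcomp_ev.
by rewrite mulrBr fcoefB => /eqP; rewrite subr_eq0 => /eqP.
Qed.

Lemma fcomp1 : fcomp 1 = 1.
Proof.
apply: fps2P => i j; rewrite /= fcoef_sum big_ord_recl fcoef_sum big_ord_recl.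
rewrite fcoefZ !expr0 mulr1 fcoef1 mul1r.
rewrite big1 ?addr0 => [|l _]; last by rewrite fcoefZ mul0r.
rewrite big1 ?addr0 // => k _; rewrite fcoef_sum big1 // => l _.
by rewrite fcoefZ mul0r.
Qed.

Lemma fcompM f g : fcomp (f * g) = fcomp f * fcomp g.
Proof.
move: f g; apply: (@fps2_ind (fun f => forall g, fcomp (f * g) = fcomp f * fcomp g)).
- by move=> g; rewrite fcomp1 !mul1r.
- by move=> f IH g; rewrite -mulrA !fcompXM IH mulrA.
- by move=> f IH g; rewrite -mulrA !fcompYM IH mulrA.
- move=> c f1 f2 IH1 IH2 g.
  by rewrite mulrDl -fps_scaleAl !linearP /= IH1 IH2 mulrDl fps_scaleAl.
move=> f IH g; apply: inmx_eq => N; have [e [h [-> hP e0]]] := IH N.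
rewrite mulrDl !linearD /= hP mulrDl opprD addrACA subrr addr0.
by apply: inmxB; [apply/fcomp_inmx/inmxMr | apply/inmxMr/fcomp_inmx].
Qed.

Lemma fcompX : fcomp X = a.
Proof. by rewrite -[X]mulr1 fcompXM fcomp1 mulr1. Qed.
Lemma fcompY : fcomp Y = b.
Proof. by rewrite -[Y]mulr1 fcompYM fcomp1 mulr1. Qed.
Lemma fcompXn f n : fcomp (f ^+ n) = fcomp f ^+ n.
Proof. by elim: n => [|n IH]; rewrite ?fcomp1 // !exprS fcompM IH. Qed.
Lemma fcomp00 f : coef (fcomp f) 0 0 = coef f 0 0.
Proof. by rewrite /= /ev !big_ord1 fcoefZ !expr0 mulr1 fcoef1 mulr1. Qed.
Lemma fcomp_unit f : (fcomp f \is a GRing.unit) = (f \is a GRing.unit).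
Proof. by rewrite !fps_unitE fcomp00. Qed.
End Comp.

Lemma coef_fcomp a b f i j : coef (fcomp a b f) i j =
  \sum_(k < (i + j).+1) \sum_(l < (i + j).+1)
    coef f k l * coef (a ^+ k * b ^+ l) i j.
Proof.
by rewrite /= fcoef_sum; apply: eq_bigr => k _; rewrite fcoef_sum.
Qed.

Lemma inmxXX n : (0 < n)%N -> inmx 1 (X ^+ n).
Proof. by case: n => // n _; apply/inmx1E; rewrite fcoefXn. Qed.
Lemma inmx1X : inmx 1 X. Proof. by apply/inmx1E. Qed.
Lemma inmx1Y : inmx 1 Y. Proof. by apply/inmx1E. Qed.

Lemma fcompA a b a' b' f :
  inmx 1 a -> inmx 1 b -> inmx 1 a' -> inmx 1 b' ->
  fcomp a b (fcomp a' b' f) = fcomp (fcomp a b a') (fcomp a b b') f.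
Proof.
move=> a0 b0 a'0 b'0; have ca := fcomp_inmx a0 b0 a'0.
have cb := fcomp_inmx a0 b0 b'0.
move: f; apply: fps2_ind.
- by rewrite !fcomp1.
- move=> f IH; rewrite (fcompM a'0 b'0) (fcompX a'0 b'0) (fcompM a0 b0).
  by rewrite (fcompM ca cb) (fcompX ca cb) IH.
- move=> f IH; rewrite (fcompM a'0 b'0) (fcompY a'0 b'0) (fcompM a0 b0).
  by rewrite (fcompM ca cb) (fcompY ca cb) IH.
- by move=> c f g IHf IHg; rewrite !linearP /= IHf IHg.
move=> f IH; apply: inmx_eq => N; have [e [h [-> hP e0]]] := IH N.
rewrite !linearD /= hP addrACA subrr addr0.
by apply: inmxB; [apply: fcomp_inmx => //; apply: fcomp_inmx | apply: fcomp_inmx].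
Qed.

Lemma fcomp_id f : fcomp X Y f = f.
Proof.
have := inmx1X; have := inmx1Y => y0 x0.
move: f; apply: fps2_ind.
- by rewrite fcomp1.
- by move=> f IH; rewrite fcompM // fcompX // IH.
- by move=> f IH; rewrite fcompM // fcompY // IH.
- by move=> c f g IHf IHg; rewrite linearP /= IHf IHg.
move=> f IH; apply: inmx_eq => N; have [e [h [-> hP e0]]] := IH N.
rewrite linearD /= hP opprD addrACA subrr addr0.
by apply: inmxB => //; apply: fcomp_inmx.
Qed.

(** * Derivations *)

Lemma dx_is_linear : linear (@dx K).
Proof.
by move=> c f g; apply: fps2P => i j /=; rewrite mulrnDl mulrnAr.
Qed.
HB.instance Definition _ := GRing.isLinear.Build K S S *:%R (@dx K) dx_is_linear.
Lemma dy_is_linear : linear (@dy K).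
Proof.
by move=> c f g; apply: fps2P => i j /=; rewrite mulrnDl mulrnAr.
Qed.
HB.instance Definition _ := GRing.isLinear.Build K S S *:%R (@dy K) dy_is_linear.

Lemma dx_inmx N f : inmx N.+1 f -> inmx N (dx f).
Proof. by move=> f0 i j ij /=; rewrite f0 ?mul0rn. Qed.
Lemma dy_inmx N f : inmx N.+1 f -> inmx N (dy f).
Proof. by move=> f0 i j ij /=; rewrite f0 ?mul0rn // addnS. Qed.

Lemma dx1 : dx (1 : S) = 0.
Proof. by apply: fps2P => i j; rewrite /= mul0rn. Qed.
Lemma dy1 : dy (1 : S) = 0.
Proof. by apply: fps2P => i j; rewrite /= andbF mul0rn. Qed.

Let dxXM f : dx (X * f) = f + X * dx f.
Proof.
apply: fps2P => i j; rewrite fcoefD fcoefXM.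
have -> : coef (dx (X * f)) i j = coef (X * f) i.+1 j *+ i.+1 by [].
by rewrite fcoefXM mulrS; case: i => //; rewrite mulr0n.
Qed.
Let dxYM f : dx (Y * f) = Y * dx f.
Proof.
apply: fps2P => i j; rewrite fcoefYM.
have -> : coef (dx (Y * f)) i j = coef (Y * f) i.+1 j *+ i.+1 by [].
by rewrite fcoefYM; case: j => //; rewrite mul0rn.
Qed.
Let dyYM f : dy (Y * f) = f + Y * dy f.
Proof.
apply: fps2P => i j; rewrite fcoefD fcoefYM.
have -> : coef (dy (Y * f)) i j = coef (Y * f) i j.+1 *+ j.+1 by [].
by rewrite fcoefYM mulrS; case: j => //; rewrite mulr0n.
Qed.
Let dyXM f : dy (X * f) = X * dy f.
Proof.
apply: fps2P => i j; rewrite fcoefXM.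
have -> : coef (dy (X * f)) i j = coef (X * f) i j.+1 *+ j.+1 by [].
by rewrite fcoefXM; case: i => //; rewrite mul0rn.
Qed.

Lemma dxM f g : dx (f * g) = dx f * g + f * dx g.
Proof.
move: f g; apply: (@fps2_ind (fun f => forall g, _ (f * g) = _ f * g + f * _ g)).
- by move=> g; rewrite dx1 !mul1r mul0r add0r.
- by move=> f IH g; rewrite -mulrA !dxXM IH; ring.
- by move=> f IH g; rewrite -mulrA !dxYM IH; ring.
- move=> c f1 f2 IH1 IH2 g.
  rewrite mulrDl -fps_scaleAl !linearP /= IH1 IH2 !scale_fpsE; ring.
move=> f IH g; apply: inmx_eq => N; have [e [h [-> hP e0]]] := IH N.+1.
rewrite mulrDl !linearD /= hP.
rewrite [Z in inmx N Z](_ : _ = dx (e * g) - (dx e * g + e * dx g)).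
  apply: inmxB; first by apply/dx_inmx/inmxMr.
  by apply: inmxD; apply: inmxMr; [apply: dx_inmx | apply: inmxW e0].
by ring.
Qed.

Lemma dyM f g : dy (f * g) = dy f * g + f * dy g.
Proof.
move: f g; apply: (@fps2_ind (fun f => forall g, _ (f * g) = _ f * g + f * _ g)).
- by move=> g; rewrite dy1 !mul1r mul0r add0r.
- by move=> f IH g; rewrite -mulrA !dyXM IH; ring.
- by move=> f IH g; rewrite -mulrA !dyYM IH; ring.
- move=> c f1 f2 IH1 IH2 g.
  rewrite mulrDl -fps_scaleAl !linearP /= IH1 IH2 !scale_fpsE; ring.
move=> f IH g; apply: inmx_eq => N; have [e [h [-> hP e0]]] := IH N.+1.
rewrite mulrDl !linearD /= hP.
rewrite [Z in inmx N Z](_ : _ = dy (e * g) - (dy e * g + e * dy g)).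
  apply: inmxB; first by apply/dy_inmx/inmxMr.
  by apply: inmxD; apply: inmxMr; [apply: dy_inmx | apply: inmxW e0].
by ring.
Qed.

(** An abstract derivation losing at most one order covers both partial derivatives; both sides are
    then continuous in f and [fps2_ind] applies. *)
Lemma chain_rule (D : {linear S -> S}) a b f :
  D 1 = 0 -> (forall f g, D (f * g) = D f * g + f * D g) ->
  (forall N f, inmx N.+1 f -> inmx N (D f)) ->
  inmx 1 a -> inmx 1 b ->
  D (fcomp a b f) = fcomp a b (dx f) * D a + fcomp a b (dy f) * D b.
Proof.
move=> D1 DM Dm a0 b0; move: f; apply: fps2_ind.
- by rewrite dx1 dy1 fcomp1 // !linear0 D1 !mul0r addr0.
- move=> f IH; rewrite dxXM dyXM !linearD /= !fcompM // !fcompX // DM IH; ring.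
- move=> f IH; rewrite dyYM dxYM !linearD /= !fcompM // !fcompY // DM IH; ring.
- by move=> c f g IHf IHg; rewrite !linearP /= IHf IHg !scale_fpsE; ring.
move=> f IH; apply: inmx_eq => N; have [e [h [-> hP e0]]] := IH N.+1.
rewrite !linearD /= hP.
rewrite [Z in inmx N Z](_ : _ = D (fcomp a b e) -
  (fcomp a b (dx e) * D a + fcomp a b (dy e) * D b)); last by ring.
apply: inmxB; first by apply/Dm/fcomp_inmx.
by apply: inmxD; apply: inmxMr; apply: fcomp_inmx => //;
  [apply: dx_inmx | apply: dy_inmx].
Qed.

Lemma dx_fcomp a b f : inmx 1 a -> inmx 1 b ->
  dx (fcomp a b f) = fcomp a b (dx f) * dx a + fcomp a b (dy f) * dx b.
Proof. by apply: (@chain_rule (@dx K)); [apply: dx1|apply: dxM|apply: dx_inmx]. Qed.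
Lemma dy_fcomp a b f : inmx 1 a -> inmx 1 b ->
  dy (fcomp a b f) = fcomp a b (dx f) * dy a + fcomp a b (dy f) * dy b.
Proof. by apply: (@chain_rule (@dy K)); [apply: dy1|apply: dyM|apply: dy_inmx]. Qed.

Lemma dxX : dx X = 1.
Proof. by rewrite -[X]mulr1 dxXM dx1 mulr0 addr0. Qed.
Lemma dyX : dy X = 0.
Proof. by rewrite -[X]mulr1 dyXM dy1 mulr0. Qed.
Lemma dxY : dx Y = 0.
Proof. by rewrite -[Y]mulr1 dxYM dx1 mulr0. Qed.
Lemma dyY : dy Y = 1.
Proof. by rewrite -[Y]mulr1 dyYM dy1 mulr0 addr0. Qed.

Lemma dx_expX n : X * dx (X ^+ n) = X ^+ n *+ n.
Proof.
elim: n => [|n IH]; first by rewrite expr0 dx1 mulr0.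
by rewrite exprS dxXM mulrDr mulrCA IH mulrS mulrnAr.
Qed.
End PowerSeries.

(** * Codimension of subspaces *)

Section Codimension.
Variables (K : fieldType) (V : lmodType K).
Implicit Types (W : V -> Prop) (u v : V).

Definition subspace W : Prop :=
  W 0 /\ forall c u v, W u -> W v -> W (c *: u + v).

Lemma subspaceB W u v : subspace W -> W u -> W v -> W (u - v).
Proof. by move=> [_ lin] Wu Wv; rewrite addrC -scaleN1r; apply: lin. Qed.
Lemma subspaceD W u v : subspace W -> W u -> W v -> W (u + v).
Proof. by move=> [_ lin] Wu Wv; rewrite -[u]scale1r; apply: lin. Qed.
Lemma subspaceZ W c u : subspace W -> W u -> W (c *: u).
Proof. by move=> [W0 lin] Wu; rewrite -[_ *: _]addr0; apply: lin. Qed.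
Lemma subspace_sum W (I : finType) (P : pred I) (F : I -> V) : subspace W ->
  (forall i, P i -> W (F i)) -> W (\sum_(i | P i) F i).
Proof.
by move=> sW; apply: big_ind => [|u v]; [case: sW | apply: subspaceD].
Qed.

(** The index type is arbitrary so that bases can be indexed by sums ([codim_extension]) and by
    products ([codim_basechange]). *)
Definition basis_mod (I : finType) W (b : I -> V) : Prop :=
  (forall u, exists c : I -> K, W (u - \sum_i c i *: b i)) /\
  (forall c : I -> K, W (\sum_i c i *: b i) -> forall i, c i = 0).

Definition has_codim W (n : nat) : Prop := exists b : 'I_n -> V, basis_mod W b.

Lemma basis_mod_codim (I : finType) W (b : I -> V) :
  basis_mod W b -> has_codim W #|I|.
Proof.
move=> [gen free]; exists (fun k => b (enum_val k)).
have E (c : 'I_#|I| -> K) :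
    \sum_k c k *: b (enum_val k) = \sum_i c (enum_rank i) *: b i.
  rewrite (reindex (fun i : I => enum_rank i)) /=; last first.
    by exists enum_val => i _; rewrite (enum_valK, enum_rankK).
  by apply: eq_bigr => i _; rewrite enum_rankK.
split=> [u|c Wc k].
  have [c Wc] := gen u; exists (fun k => c (enum_val k)); rewrite E.
  by under eq_bigr do rewrite enum_rankK.
by rewrite E in Wc; have := free _ Wc (enum_val k); rewrite enum_valK.
Qed.

(** Expressing one basis in the other and back gives matrices with product 1 of size n that factors
    through size m. *)
Lemma codim_leq W n m : subspace W -> has_codim W n -> has_codim W m ->
  (n <= m)%N.
Proof.
move=> sW [b [bgen bfree]] [b' [gen' free']].
have [C CP] := choice (fun i => gen' (b i)).
have [D DP] := choice (fun i => bgen (b' i)).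
pose MC := \matrix_(i, j) C i j; pose MD := \matrix_(i, j) D i j.
apply: (@mulmx1_min K n m MC MD); apply/matrixP => i k; rewrite !mxE.
under eq_bigr do rewrite !mxE.
apply/eqP; rewrite -subr_eq0; apply/eqP.
apply: (bfree (fun k => \sum_j C i j * D j k - (i == k)%:R)).
have -> : \sum_k (\sum_j C i j * D j k - (i == k)%:R) *: b k =
    - (b i - \sum_j C i j *: b' j) -
    \sum_j C i j *: (b' j - \sum_k D j k *: b k).
  under [in LHS]eq_bigr do rewrite scalerBl scaler_suml.
  rewrite sumrB exchange_big /=.
  have -> : \sum_k (i == k)%:R *: b k = b i.
    rewrite (bigD1 i) //= eqxx scale1r big1 ?addr0 // => l.
    by rewrite eq_sym => /negPf ->; rewrite scale0r.
  have -> : \sum_j C i j *: (b' j - \sum_k D j k *: b k) =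
      \sum_j C i j *: b' j - \sum_j \sum_k (C i j * D j k) *: b k.
    rewrite -sumrB; apply: eq_bigr => j _; rewrite scalerBr scaler_sumr.
    by congr (_ - _); apply: eq_bigr => l _; rewrite scalerA.
  by rewrite !opprB [RHS]addrC addrA subrK.
apply: subspaceB => //; first by rewrite -scaleN1r; apply: subspaceZ.
by apply: subspace_sum => // j _; apply: subspaceZ.
Qed.

Lemma codim_unique W n m : subspace W -> has_codim W n -> has_codim W m -> n = m.
Proof. by move=> *; apply/eqP; rewrite eqn_leq !(@codim_leq W). Qed.

Lemma codim_spanned W (n : nat) (b : 'I_n -> V) : subspace W ->
  (forall u, exists c : 'I_n -> K, W (u - \sum_i c i *: b i)) ->
  exists m, has_codim W m.
Proof.
move=> sW; elim: n b => [|n IH] b gen.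
  by exists 0%N, b; split=> // c _ [].
have [free|] := pselect (forall c : 'I_n.+1 -> K,
  W (\sum_i c i *: b i) -> forall i, c i = 0); first by exists n.+1, b.
move=> /existsNP [c /not_implyP [Wc /existsNP [k /eqP ck]]].
apply: (IH (fun i => b (lift k i))) => u; have [d Wd] := gen u.
(* Subtracting [d k / c k] times the relation [c] eliminates the generator [b k]. *)
exists (fun i => d (lift k i) - d k / c k * c (lift k i)).
have -> : u - \sum_i (d (lift k i) - d k / c k * c (lift k i)) *: b (lift k i)
   = (d k / c k) *: (\sum_i c i *: b i) + (u - \sum_i d i *: b i).
  rewrite !(bigD1_ord k) //= scalerDr scalerA divfK //.
  rewrite [RHS]addrCA opprD addrACA subrr add0r; congr (u + _).
  rewrite scaler_sumr -[RHS]sumrB -sumrN /=.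
  by apply: eq_bigr => i _; rewrite scalerBl opprB scalerA.
by case: (sW) => _; apply.
Qed.

Lemma codim_sup W W' n : subspace W' -> (forall u, W u -> W' u) ->
  has_codim W n -> exists m, has_codim W' m.
Proof.
move=> sW' WW' [b [gen _]]; apply: (codim_spanned (b := b)) => // u.
by have [c /WW'] := gen u; exists c.
Qed.

(** Dimension is additive along the exact sequence from V / phi^-1(W) to V / W to V / (W + phi
    V). *)
Lemma codim_extension (phi : {linear V -> V}) W n m : subspace W ->
  has_codim (fun u => W (phi u)) n ->
  has_codim (fun u => exists v, W (u - phi v)) m ->
  has_codim W (n + m).
Proof.
move=> sW [b [gen free]] [b' [gen' free']].
rewrite -[n]card_ord -[m]card_ord -card_sum.
pose bb (i : 'I_n + 'I_m) := match i with inl i => phi (b i) | inr i => b' i end.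
apply: (@basis_mod_codim _ W bb).
have E (c : 'I_n + 'I_m -> K) : \sum_i c i *: bb i =
    phi (\sum_i c (inl i) *: b i) + \sum_i c (inr i) *: b' i.
  rewrite big_sumType /=; congr (_ + _); rewrite linear_sum.
  by apply: eq_bigr => i _; rewrite linearZ.
split=> [u|c].
  have [c' [v Wv]] := gen' u; have [c Wc] := gen v.
  exists (fun i => match i with inl i => c i | inr i => c' i end).
  rewrite E; move: (subspaceD sW Wv Wc); rewrite linearB /=.
  by rewrite addrA subrK opprD addrA [_ - phi _ - _]addrAC.
rewrite E => Wc.
have cr i : c (inr i) = 0.
  apply: (free' (fun i => c (inr i))).
  by exists (- (\sum_i c (inl i) *: b i)); rewrite linearN opprK addrC.
rewrite [X in _ + X]big1 ?addr0 in Wc => [|i _]; last by rewrite cr scale0r.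
by case=> i //; apply: (free (fun i => c (inl i))).
Qed.

Lemma codim_ext W W' n : (forall u, W u <-> W' u) -> has_codim W n ->
  has_codim W' n.
Proof.
move=> WW' [b [gen free]]; exists b; split=> [u|c /WW']; last exact: free.
by have [c /WW'] := gen u; exists c.
Qed.
End Codimension.

(** * Intersection numbers *)

Section Intersection.
Variable K : fieldType.
Local Notation S := (fps2 K).
Local Notation X := (fX K).
Local Notation Y := (fY K).
Implicit Types (f g h u : S) (c : K).

Definition ideal2 f g u : Prop := exists r s, u = r * f + s * g.

Lemma ideal2_subspace f g : subspace (ideal2 f g).
Proof.
split=> [|c u v [r [s ->]] [r' [s' ->]]]; first by exists 0, 0; ring.
by exists (c *: r + r'), (c *: s + s'); rewrite !scale_fpsE; ring.
Qed.
Hint Resolve ideal2_subspace : core.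

Lemma ideal2_l f g : ideal2 f g f.
Proof. by exists 1, 0; ring. Qed.
Lemma ideal2_r f g : ideal2 f g g.
Proof. by exists 0, 1; ring. Qed.
Lemma ideal2D f g u v : ideal2 f g u -> ideal2 f g v -> ideal2 f g (u + v).
Proof. exact: subspaceD. Qed.
Lemma ideal2Ml f g u v : ideal2 f g v -> ideal2 f g (u * v).
Proof. by move=> [r [s ->]]; exists (u * r), (u * s); ring. Qed.
Lemma ideal2_sub f g f' g' u : ideal2 f' g' f -> ideal2 f' g' g ->
  ideal2 f g u -> ideal2 f' g' u.
Proof. by move=> If Ig [r [s ->]]; apply: ideal2D; apply: ideal2Ml. Qed.
Lemma ideal2C f g u : ideal2 f g u -> ideal2 g f u.
Proof. by apply: ideal2_sub; [apply: ideal2_r | apply: ideal2_l]. Qed.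

(** Unique coordinates for every u split into generation and freeness; freeness is uniqueness at u =
    0. *)
Lemma has_intersection_numberE g h n :
  has_intersection_number g h n <-> has_codim (ideal2 g h) n.
Proof.
split=> [[b bP]|[b [gen free]]]; exists b.
  split=> [u|c [r [s E]] i].
    have [c [[r [s ->]] _]] := bP u; by exists c, r, s; rewrite addrC addrA addNr add0r.
  have [c0 [_ c0P]] := bP 0.
  have <- : c0 i = c i.
    rewrite (c0P [ffun i => c i]) ?ffunE //; exists (- r), (- s).
    under eq_bigr do rewrite ffunE.
    by rewrite E; ring.
  rewrite (c0P [ffun i => 0]) ?ffunE //; exists 0, 0.
  by rewrite big1 ?mul0r ?addr0 // => j _; rewrite ffunE scale0r.
move=> u; have [c [r [s E]]] := gen u; exists [ffun i => c i]; split.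
  exists r, s; rewrite -E addrC; under [X in _ + X]eq_bigr do rewrite ffunE.
  by rewrite subrK.
move=> c' [r' [s' E']]; apply/ffunP => i; rewrite ffunE.
apply/eqP; rewrite -subr_eq0; apply/eqP; move: i; apply: free.
under eq_bigr do rewrite scalerBl.
rewrite sumrB; exists (r' - r), (s' - s).
have -> : \sum_i c i *: b i = u - (r * g + s * h).
  by rewrite -E opprB addrC subrK.
have -> : \sum_i c' i *: b i = u - (r' * g + s' * h) by rewrite E' addrK.
by ring.
Qed.

Lemma inter_ext f g f' g' :
  (forall u, ideal2 f g u <-> ideal2 f' g' u) ->
  intersection_number f g = intersection_number f' g'.
Proof.
move=> E; rewrite /intersection_number; congr (xget _ _).
apply/seteqP; split=> n /has_intersection_numberE H;
  by apply/has_intersection_numberE; apply: codim_ext H => u; rewrite E.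
Qed.

Lemma inter_eq f g n : has_codim (ideal2 f g) n -> intersection_number f g = n.
Proof.
move=> H; rewrite /intersection_number.
apply: xget_unique => [|m]; first exact/has_intersection_numberE.
by move=> /has_intersection_numberE H'; apply: codim_unique H' H.
Qed.

Lemma interC f g : intersection_number f g = intersection_number g f.
Proof. by apply: inter_ext => u; split; apply: ideal2C. Qed.

Lemma inter_ideal f g h : ideal2 f g h -> ideal2 f h g -> 
  intersection_number f g = intersection_number f h.
Proof.
move=> fgh fhg; apply: inter_ext => u.
by split; apply: ideal2_sub => //; apply: ideal2_l.
Qed.

(* Equivalent to the quotient by (f, g) being finite-dimensional. *)
Definition finite2 f g : Prop :=
  exists N, ideal2 f g (X ^+ N) /\ ideal2 f g (Y ^+ N).

Lemma ideal2_exp_leq f g u n m : (n <= m)%N -> ideal2 f g (u ^+ n) ->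
  ideal2 f g (u ^+ m).
Proof. by move=> nm I; rewrite -(subnK nm) exprD; apply: ideal2Ml. Qed.

Lemma finite2I f g n m : ideal2 f g (X ^+ n) -> ideal2 f g (Y ^+ m) ->
  finite2 f g.
Proof.
move=> In Im; exists (maxn n m).
by split; apply: ideal2_exp_leq; [apply: leq_maxl| |apply: leq_maxr|].
Qed.

Lemma finite2_sub f g f' g' : ideal2 f' g' f -> ideal2 f' g' g ->
  finite2 f g -> finite2 f' g'.
Proof. by move=> If Ig [N [? ?]]; exists N; split; apply: ideal2_sub If Ig _. Qed.

Lemma finite2C f g : finite2 f g -> finite2 g f.
Proof. by apply: finite2_sub; [apply: ideal2_r | apply: ideal2_l]. Qed.

Lemma finite2Ml f g h : finite2 f (g * h) -> finite2 f h.
Proof.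
by apply: finite2_sub; [apply: ideal2_l | apply/ideal2Ml/ideal2_r].
Qed.
Lemma finite2Mr f g h : finite2 f (g * h) -> finite2 f g.
Proof. by rewrite mulrC; apply: finite2Ml. Qed.

Lemma ideal2_mul f g h u v : ideal2 f g u -> ideal2 f h v ->
  ideal2 f (g * h) (u * v).
Proof.
move=> [r [s ->]] [r' [s' ->]].
by exists (r * r' * f + r * s' * h + s * g * r'), (s * s'); ring.
Qed.

Lemma finite2M f g h : finite2 f g -> finite2 f h -> finite2 f (g * h).
Proof.
move=> [N [x y]] [M [x' y']]; apply: (@finite2I _ _ (N + M) (N + M));
  by rewrite exprD; apply: ideal2_mul.
Qed.

(* From X^N u = f s and Y^N u = f r one gets Y^N s = X^N r, so X^N divides s. *)
Lemma finite2_regular f g u r : finite2 f g -> g * u = f * r ->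
  exists v, u = f * v.
Proof.
move=> [N [[a [b xE]] [a' [b' yE]]]] E.
pose s := a * u + b * r; pose s' := a' * u + b' * r.
have xu : X ^+ N * u = f * s.
  rewrite xE (_ : _ * u = f * (a * u) + b * (g * u)); last by ring.
  by rewrite E /s; ring.
have yu : Y ^+ N * u = f * s'.
  rewrite yE (_ : _ * u = f * (a' * u) + b' * (g * u)); last by ring.
  by rewrite E /s'; ring.
have [f0|f0] := eqVneq f 0.
  exists 0; move/eqP: xu; rewrite f0 !mul0r mulf_eq0 expf_eq0.
  by rewrite (negPf (X_neq0 K)) andbF => /eqP.
have ss : Y ^+ N * s = X ^+ N * s'.
  by apply: (mulfI f0); rewrite mulrCA -xu mulrCA yu mulrCA.
have [|v sE] := @divXnP K N s.
  move=> i j iN; have := congr1 (fun h => coef h i (j + N)) ss.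
  by rewrite fcoefYnM leq_addl addnK fcoefXnM leqNgt iN.
exists v; apply: (@mulfI _ (X ^+ N)); first by rewrite expf_neq0 ?X_neq0.
by rewrite xu sE mulrCA.
Qed.

Definition mulL g : S -> S := fun u => g * u.
Lemma mulL_linear g : linear (mulL g).
Proof. by move=> c u v; rewrite /mulL mulrDr -fps_scaleAr. Qed.
HB.instance Definition _ g := GRing.isLinear.Build K S S *:%R (mulL g) (mulL_linear g).

(** Finiteness makes g a non-zero-divisor modulo f, so multiplication by g is injective from the
    quotient by (f, h) to the quotient by (f, gh). *)
Lemma ideal2_cancel f g h u : finite2 f g ->
  ideal2 f h u <-> ideal2 f (g * h) (g * u).
Proof.
move=> fg; split=> [[r [s ->]]|[r [s E]]]; first by exists (g * r), s; ring.
have [|v vE] := @finite2_regular f g (u - s * h) r fg.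
  by rewrite mulrBr E; ring.
by exists v, s; rewrite -[LHS](subrK (s * h)) vE; ring.
Qed.

Lemma ideal2_mod f g h u :
  ideal2 f g u <-> exists v, ideal2 f (g * h) (u - g * v).
Proof.
split=> [[r [s ->]]|[v [r [s E]]]]; first by exists s, r, 0; ring.
by exists r, (v + s * h); rewrite -[LHS](subrK (g * v)) E; ring.
Qed.

(** [codim_extension] for multiplication by g: the quotient by (f, h) is the kernel side, the
    quotient by (f, g) the cokernel. *)
Lemma codimM f g h n m : finite2 f g ->
  has_codim (ideal2 f h) n -> has_codim (ideal2 f g) m ->
  has_codim (ideal2 f (g * h)) (n + m).
Proof.
move=> fg Hh Hg; apply: (@codim_extension _ _ (mulL g)) => //.
  by apply: codim_ext Hh => u; apply: ideal2_cancel.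
by apply: codim_ext Hg => u; apply: ideal2_mod.
Qed.

Lemma codim_unit f g : g \is a GRing.unit -> has_codim (ideal2 f g) 0.
Proof.
move=> gu; exists (fun _ => 0); split=> [u|c _ []//]; exists (fun _ => 0).
by rewrite big_ord0 subr0; exists 0, (u / g); rewrite divrK //; ring.
Qed.

Lemma codim_XY : has_codim (ideal2 X Y) 1.
Proof.
exists (fun _ => 1); split=> [u|c [r [s E]] i].
  have [|q [r [-> r0]]] := @weierstrass_division K Y 1 _ u.
    by split=> [|[]]; rewrite /= ?oner_eq0.
  have [|s sE] := @divXnP K 1 (r - coef r 0 0 *: 1).
    move=> [|i] [|j] //= _; rewrite ?mulr1 ?subrr // r0 // mulr0 subrr //.
  exists (fun _ => coef r 0 0); rewrite big_ord1 -addrA sE.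
  by exists s, q; ring.
have := congr1 (fun h => coef h 0 0) E.
rewrite big_ord1 fcoefZ fcoef1 mulr1 fcoefD !fcoef00M /= !mulr0 addr0.
by rewrite (ord1 i).
Qed.

Lemma finite2_unit f g : g \is a GRing.unit -> finite2 f g.
Proof.
by move=> gu; exists 0%N; split; exists 0, g^-1; rewrite mulVr //; ring.
Qed.

Lemma codim_expr f g n : finite2 f g -> (exists m, has_codim (ideal2 f g) m) ->
  exists m, has_codim (ideal2 f (g ^+ n)) m.
Proof.
move=> fg [m fgm]; elim: n => [|n [k IH]].
  by exists 0%N; apply: codim_unit; rewrite expr0 unitr1.
by exists (k + m)%N; rewrite exprS; apply: codimM.
Qed.

(** The ideal contains (x^N, y^N), whose codimension is finite by additivity starting from (x,
    y). *)
Lemma finite2_codim f g : finite2 f g ->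
  has_codim (ideal2 f g) (intersection_number f g).
Proof.
move=> [N [xN yN]].
have XY : finite2 X Y by exists 1%N; split; [apply: ideal2_l | apply: ideal2_r].
have XYN : finite2 X (Y ^+ N).
  exists N.+1; split; last by rewrite exprS; apply/ideal2Ml/ideal2_r.
  by rewrite exprSr; apply/ideal2Ml/ideal2_l.
have [m Hm] := codim_expr N XY (ex_intro _ _ codim_XY).
have [|k Hk] := codim_expr N (finite2C XYN).
  by exists m; apply: codim_ext Hm => u; split; apply: ideal2C.
have [|l Hl] := codim_sup (ideal2_subspace f g) _ Hk.
  by move=> u; apply: ideal2_sub.
by rewrite (inter_eq Hl).
Qed.

Lemma inter_unit f g : g \is a GRing.unit -> intersection_number f g = 0%N.
Proof. by move=> gu; apply/inter_eq/codim_unit. Qed.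

Lemma interM f g h : finite2 f (g * h) -> intersection_number f (g * h) =
  (intersection_number f g + intersection_number f h)%N.
Proof.
move=> fgh; have fg := finite2Mr fgh; have fh := finite2Ml fgh.
by rewrite addnC; apply/inter_eq/codimM => //; apply: finite2_codim.
Qed.

Lemma finite2X f g n : finite2 f g -> finite2 f (g ^+ n).
Proof.
move=> fg; elim: n => [|n IH]; first by apply: finite2_unit; apply: unitr1.
by rewrite exprS; apply: finite2M.
Qed.

Lemma interX f g n : finite2 f g ->
  intersection_number f (g ^+ n) = (n * intersection_number f g)%N.
Proof.
move=> fg; elim: n => [|n IH]; first by apply: inter_unit; apply: unitr1.
by rewrite exprS interM -?exprS ?IH //; apply: finite2X.
Qed.

Lemma interD f g h : intersection_number f (g + h * f) = intersection_number f g.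
Proof.
apply: inter_ideal; last by exists h, 1; ring.
by exists (- h), 1; ring.
Qed.

Lemma finite2D f g h : finite2 f g -> finite2 f (g + h * f).
Proof. by apply: finite2_sub; [apply: ideal2_l | exists (- h), 1; ring]. Qed.

Lemma finite2Z f g c : c != 0 -> finite2 f g -> finite2 f (c *: g).
Proof.
move=> c0; apply: finite2_sub; first exact: ideal2_l.
by exists 0, (fC c^-1); rewrite -scale_fpsE scalerA mulVf // scale1r; ring.
Qed.

Lemma interZ f g c : c != 0 ->
  intersection_number f (c *: g) = intersection_number f g.
Proof.
move=> c0; apply: inter_ideal.
  by exists 0, (fC c^-1); rewrite -scale_fpsE scalerA mulVf // scale1r; ring.
by exists 0, (fC c); rewrite -scale_fpsE; ring.
Qed.

Lemma divYnP n f :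
  (forall i j, (j < n)%N -> coef f i j = 0) -> exists g, f = Y ^+ n * g.
Proof.
move=> f0; exists (Fps2 (fun i j => coef f i (j + n))).
apply: fps2P => i j; rewrite fcoefYnM; case: leqP => ni /=; last by rewrite f0.
by rewrite subnK.
Qed.

(** A form of finiteness that does not single out the coordinates, hence survives a change of
    coordinates. *)
Lemma finite2_inmx f g : finite2 f g ->
  exists N, forall u, inmx N u -> ideal2 f g u.
Proof.
move=> [N [xN yN]]; exists (N + N)%N => u u0.
(* [u - v] is divisible by [X ^+ N]; the monomials left in [v] have total degree at least 2N and
   degree below N in x, so they are divisible by [Y ^+ N]. *)
pose v : S := Fps2 (fun i j => if (i < N)%N then coef u i j else 0).
have [|a aE] := @divXnP K N (u - v).
  by move=> i j iN; rewrite fcoefB /= iN subrr.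
have [|b bE] := @divYnP N v.
  by move=> i j jN /=; case: ltnP => // iN; rewrite u0 //; lia.
rewrite -[u](subrK v) aE bE mulrC [Y ^+ N * b]mulrC.
by apply: ideal2D; apply: ideal2Ml.
Qed.

(** * Change of coordinates *)

Section Automorphism.
Variables a b a' b' : S.
Hypothesis a0 : inmx 1 a.
Hypothesis b0 : inmx 1 b.
Hypothesis a'0 : inmx 1 a'.
Hypothesis b'0 : inmx 1 b'.
Hypothesis invK : cancel (fcomp a b) (fcomp a' b').
Hypothesis invK' : cancel (fcomp a' b') (fcomp a b).

Lemma ideal2_comp f g u : ideal2 f g u ->
  ideal2 (fcomp a b f) (fcomp a b g) (fcomp a b u).
Proof.
move=> [r [s ->]]; exists (fcomp a b r), (fcomp a b s).
by rewrite linearD /= !fcompM.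
Qed.

Lemma codim_comp f g n : has_codim (ideal2 f g) n ->
  has_codim (ideal2 (fcomp a b f) (fcomp a b g)) n.
Proof.
move=> [e [gen free]]; exists (fun i => fcomp a b (e i)).
have E (c : 'I_n -> K) : \sum_i c i *: fcomp a b (e i) = fcomp a b (\sum_i c i *: e i).
  by rewrite linear_sum; apply: eq_bigr => i _; rewrite linearZ.
split=> [u|c]; rewrite ?E.
  have [c /ideal2_comp] := gen (fcomp a' b' u).
  by rewrite linearB /= invK'; exists c; rewrite E.
move=> [r [s H]]; apply: free; exists (fcomp a' b' r), (fcomp a' b' s).
apply: (can_inj invK); rewrite H linearD /= !fcompM //.
by rewrite !invK'.
Qed.

Lemma finite2_comp f g : finite2 f g -> finite2 (fcomp a b f) (fcomp a b g).
Proof.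
move=> /finite2_inmx [N fgN]; exists N.
by split; rewrite -[_ ^+ _]invK'; apply/ideal2_comp/fgN;
  rewrite fcompXn // ?fcompX ?fcompY //; apply: inmxX.
Qed.

Lemma inter_comp f g : finite2 f g ->
  intersection_number (fcomp a b f) (fcomp a b g) = intersection_number f g.
Proof. by move=> /finite2_codim fg; apply/inter_eq/codim_comp. Qed.
End Automorphism.

(** * Ramified base change: x replaced by x^N *)

Section BaseChange.
Variable N : nat.
Hypothesis N0 : (0 < N)%N.
Let beta := fcomp (X ^+ N) Y.
(** The ring is free over the image of [beta] with basis 1, x, ..., x^(N-1); [pi j] is the
    coordinate on x^j. *)
Let pi j u : S := Fps2 (fun i l => coef u (N * i + j) l).

Let XN0 : inmx 1 (X ^+ N). Proof. exact: inmxXX. Qed.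
Let Y0 := @inmx1Y K.

Let coef_beta f i j :
  coef (beta f) i j = if (N %| i)%N then coef f (i %/ N) j else 0.
Proof.
rewrite coef_fcomp.
under eq_bigr do under eq_bigr do rewrite -exprM fcoef_monom.
have jlt : (j < (i + j).+1)%N by rewrite ltnS leq_addl.
case: dvdnP => [[k ->]|nd].
  have klt : (k < (k * N + j).+1)%N by rewrite ltnS; nia.
  rewrite mulnK // (bigD1 (Ordinal klt)) // -[LHS]/(_ + _) [X in _ + X]big1.
    have jlt' : (j < (k * N + j).+1)%N by rewrite ltnS leq_addl.
    rewrite addr0 (bigD1 (Ordinal jlt')) // -[LHS]/(_ + _) [X in _ + X]big1.
      by rewrite /= mulnC !eqxx mulr1 addr0.
    move=> l lj; case: (j =P l) => [jl|]; last by rewrite andbF mulr0.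
    by case/eqP: lj; apply/val_inj.
  move=> l lk; rewrite big1 // => m _.
  rewrite [(N * l)%N]mulnC eqn_pmul2r //.
  case: (k =P l) => [kl|]; last by rewrite mulr0.
  by case/eqP: lk; apply/val_inj.
rewrite big1 // => k _; rewrite big1 // => l _.
case: eqP => [iE|]; last by rewrite mulr0.
by case: nd; exists k; rewrite [RHS]mulnC.
Qed.

Let pi_linear j : linear (pi j).
Proof. by move=> c f g; apply: fps2P. Qed.
HB.instance Definition _ j := GRing.isLinear.Build K S S *:%R (pi j) (pi_linear j).

Let pi_beta (j k : 'I_N) h : pi j (X ^+ k * beta h) = if k == j then h else 0.
Proof.
apply: fps2P => i l.
have -> : coef (pi j (X ^+ k * beta h)) i l = coef (X ^+ k * beta h) (N * i + j) l.
  by [].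
rewrite fcoefXnM coef_beta.
case: eqP => [->|kj]; first by rewrite leq_addl addnK dvdn_mulr // mulKn.
case: leqP => // kji; case: dvdnP => // -[q qE]; case: kj; apply: val_inj.
have := congr1 (modn^~ N) (subnK kji).
by rewrite qE modnMDl mulnC modnMDl !modn_small.
Qed.

Let decomp u : u = \sum_(j < N) X ^+ j * beta (pi j u).
Proof.
apply: fps2P => i l; rewrite fcoef_sum.
have im : (i %% N < N)%N by rewrite ltn_mod.
rewrite (bigD1 (Ordinal im)) // -[RHS]/(_ + _) [X in _ + X]big1 => [|j ji].
  have iE : (i - i %% N = i %/ N * N)%N by rewrite {1}(divn_eq i N) addnK.
  rewrite fcoefXnM leq_mod coef_beta /= iE dvdn_mull // mulnK // mulnC.
  by rewrite -divn_eq addr0.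
rewrite fcoefXnM coef_beta; case: leqP => // ij; case: dvdnP => // -[q qE].
case/eqP: ji; apply: val_inj => /=.
by rewrite -(subnK ij) qE modnMDl modn_small.
Qed.

Let pi_mul j u h : (j < N)%N -> pi j (u * beta h) = pi j u * h.
Proof.
move=> jN; rewrite {1}(decomp u) mulr_suml linear_sum /=.
under eq_bigr do rewrite -mulrA -fcompM // -/beta.
by under eq_bigr do rewrite (pi_beta (Ordinal jN)); rewrite -big_mkcond big_pred1_eq.
Qed.

(** Freeness of rank N: the products of x^k, k < N, with the pulled-back basis form a basis. *)
Lemma codim_basechange f g n : has_codim (ideal2 f g) n ->
  has_codim (ideal2 (beta f) (beta g)) (N * n).
Proof.
move=> [b [gen free]]; rewrite -[N in (N * n)%N]card_ord -[n]card_ord -card_prod.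
apply: (@basis_mod_codim _ _ _ _ (fun k : 'I_N * 'I_n => X ^+ k.1 * beta (b k.2))).
have E (c : 'I_N * 'I_n -> K) :
    \sum_k c k *: (X ^+ k.1 * beta (b k.2)) =
    \sum_(j < N) X ^+ j * beta (\sum_i c (j, i) *: b i).
  transitivity (\sum_(j < N) \sum_i c (j, i) *: (X ^+ j * beta (b i))).
    by rewrite pair_bigA; apply: eq_bigr => -[].
  apply: eq_bigr => j _; rewrite /beta linear_sum mulr_sumr.
  by apply: eq_bigr => i _; rewrite linearZ -fps_scaleAr.
split=> [u|c]; rewrite ?E.
  have [c cP] := choice (fun j : 'I_N => gen (pi j u)).
  exists (fun k => c k.1 k.2); rewrite E {1}(decomp u) -sumrB.
  apply: subspace_sum => // j _; rewrite -mulrBr /beta -linearB.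
  by apply: ideal2Ml; apply: ideal2_comp => //; apply: cP.
move=> [r [s H]] [j i]; apply: (free (fun i => c (j, i))).
exists (pi j r), (pi j s); rewrite -!pi_mul // -linearD /= -H linear_sum /=.
under [RHS]eq_bigr do rewrite pi_beta.
by rewrite -big_mkcond big_pred1_eq.
Qed.

Lemma finite2_basechange f g : finite2 f g <-> finite2 (beta f) (beta g).
Proof.
split=> [[M [x y]]|[M [x y]]].
  apply: (@finite2I _ _ (N * M) M).
    by have := ideal2_comp XN0 Y0 x; rewrite fcompXn // fcompX // exprM.
  by have := ideal2_comp XN0 Y0 y; rewrite fcompXn // fcompY.
(* [pi 0] is a retraction of [beta], linear over its image, so it brings ideal membership back
   down. *)
have piI u : ideal2 (beta f) (beta g) (beta u) -> ideal2 f g u.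
  move=> [r [s E]]; exists (pi 0 r), (pi 0 s).
  rewrite -!pi_mul // -linearD /= -E.
  by rewrite -[beta u]mul1r pi_mul // -{1}[u]mul1r; congr (_ * _);
    apply: fps2P => i j; rewrite /= addn0 muln_eq0 (gtn_eqF N0).
exists M; split; apply: piI.
  rewrite /beta fcompXn // fcompX // -exprM; apply: ideal2_exp_leq x.
  by rewrite leq_pmull.
by rewrite /beta fcompXn // fcompY.
Qed.

Lemma inter_basechange f g : finite2 f g ->
  intersection_number (beta f) (beta g) = (N * intersection_number f g)%N.
Proof. by move=> /finite2_codim fg; apply/inter_eq/codim_basechange. Qed.
End BaseChange.

(** * Coprime series generate an ideal of finite codimension *)

(** Once x is inverted, the ideal is generated by an element [d] of least order in y. It divides f
    and g, so coprimality makes it a unit. *)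
Lemma rel_prime_Xn f g : rel_prime f g -> exists N, ideal2 f g (X ^+ N).
Proof.
move=> fg.
pose P n := `[< exists d N, yregular d n /\ ideal2 f g (X ^+ N * d) >].
have exP u : u != 0 -> ideal2 f g u -> exists n, P n.
  move=> /yregular_Xn [k [n [d [-> dn]]]] I.
  by exists n; apply/asboolP; exists d, k.
have /ex_minnP [n /asboolP [d [N [dn I]]] nmin] : exists n, P n.
  have [f0|f0] := eqVneq f 0; last exact: exP f0 (ideal2_l _ _).
  have [g0|g0] := eqVneq g 0; last exact: exP g0 (ideal2_r _ _).
  have : X \is a GRing.unit by apply: fg; exists 0; rewrite ?f0 ?g0 mul0r.
  by rewrite fps_unitE eqxx.
have dvd u : ideal2 f g u -> divides d u.
  move=> Iu; have [q [r [E r0]]] := weierstrass_division dn u.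
  have [r_0|rn0] := eqVneq r 0; first by exists q; rewrite E r_0 addr0.
  have [k [m [d' [rE d'm]]]] := yregular_Xn rn0.
  have Ir : ideal2 f g (X ^+ N * r).
    have -> : r = u - q * d by rewrite E addrC addKr.
    rewrite mulrBr mulrCA; apply: subspaceB => //; exact: ideal2Ml.
  (* Minimality of n forces the order m of the remainder up to n, whereas division leaves no
     monomial of degree n or more in y. *)
  have : (n <= m)%N.
    apply: nmin; apply/asboolP; exists d', (N + k)%N; split=> //.
    by rewrite exprD -mulrA -rE.
  move=> nm; have [+ _] := d'm.
  have <- : coef r k m = coef d' 0 m by rewrite rE fcoefXnM leqnn subnn.
  by rewrite r0 ?eqxx.
have du : d \is a GRing.unit by apply: fg; apply: dvd; [apply: ideal2_l|apply: ideal2_r].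
by exists N; rewrite -[_ ^+ _](mulrK du) mulrC; apply: ideal2Ml.
Qed.

Lemma swapK : involutive (fcomp Y X).
Proof.
move=> f; rewrite fcompA ?fcompX ?fcompY ?fcomp_id //;
  by [apply: inmx1X | apply: inmx1Y].
Qed.

(** The power of y comes from the previous lemma after exchanging the coordinates. *)
Lemma rel_prime_finite2 f g : rel_prime f g -> finite2 f g.
Proof.
have y0 := @inmx1Y K; have x0 := @inmx1X K.
move=> fg; have [N xN] := rel_prime_Xn fg.
have [|M] := @rel_prime_Xn (fcomp Y X f) (fcomp Y X g).
  move=> d [q qE] [r rE]; rewrite -(fcomp_unit Y X); apply: fg.
    by exists (fcomp Y X q); rewrite -fcompM // -qE swapK.
  by exists (fcomp Y X r); rewrite -fcompM // -rE swapK.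
move=> /(ideal2_comp y0 x0); rewrite !swapK fcompXn // fcompX // => yM.
exact: finite2I xN yM.
Qed.
End Intersection.

(** * Newton-Puiseux *)

Section Regular.
Variable K : fieldType.
Local Notation S := (fps2 K).
Local Notation X := (fX K).
Local Notation Y := (fY K).
Implicit Types (f g h u : S) (c : K).

Lemma yregular_unit f : f \is a GRing.unit -> yregular f 0.
Proof. by rewrite fps_unitE; split. Qed.

Lemma yregularYn n : yregular (Y ^+ n) n.
Proof.
have E j : coef (Y ^+ n) 0 j = (j == n)%:R.
  by rewrite -[Y ^+ n]mul1r -(expr0 X) fcoef_monom.
by split=> [|j jn]; rewrite E ?eqxx ?oner_eq0 // ltn_eqF.
Qed.

Lemma yregular_addX f g n : yregular f n -> yregular (X * g + f) n.
Proof.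
by move=> [fn f0]; split=> [|j jn]; rewrite fcoefD fcoefXM add0r // f0.
Qed.

Lemma yregularP f n :
  yregular f n -> exists g u, u \is a GRing.unit /\ f = X * g + Y ^+ n * u.
Proof.
move=> [fn f0]; pose u : S := Fps2 (fun i j => if i == 0%N then coef f 0 (n + j) else 0).
have [|g gE] := @divXnP K 1 (f - Y ^+ n * u).
  move=> [|i] j // _; rewrite fcoefB fcoefYnM /=; case: leqP => nj.
    by rewrite subnKC // subrr.
  by rewrite f0 // subrr.
exists g, u; split; first by rewrite fps_unitE /= addn0.
by rewrite -[X]expr1 -gE subrK.
Qed.

Lemma yregular_inj f n m : yregular f n -> yregular f m -> n = m.
Proof.
move=> [fn f0] [fm f0']; case: (ltngtP n m) => // nm.
  by rewrite f0' ?eqxx in fn.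
by rewrite f0 ?eqxx in fm.
Qed.

Lemma yregular_inmx f n : (0 < n)%N -> yregular f n -> inmx 1 f.
Proof. by move=> n0 [_ f0]; apply/inmx1E/f0. Qed.

Lemma yregular_fcomp a b f n : yregular b 1 -> yregular f n ->
  yregular (fcomp (X * a) b f) n.
Proof.
move=> b1 /yregularP [g [u [uu ->]]].
have a0 : inmx 1 (X * a) by apply/inmx1E; rewrite fcoefXM.
have b0 : inmx 1 b by apply: yregular_inmx b1.
rewrite linearD /= !fcompM // fcompX // -mulrA; apply: yregular_addX.
rewrite -[n in yregular _ n]addn0; apply: yregularM; last first.
  by apply: yregular_unit; rewrite fcomp_unit.
rewrite fcompXn // fcompY //; elim: n => [|n IH].
  by apply: yregular_unit; rewrite expr0 unitr1.
by rewrite exprS -add1n; apply: yregularM.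
Qed.

Lemma yregular_divr f g n m : yregular (f * g) (n + m) -> yregular g m ->
  yregular f n.
Proof.
move=> fg gm; have [f0|] := eqVneq f 0.
  by have [] := fg; rewrite f0 mul0r eqxx.
move=> /yregular_Xn [[|k] [l [f1 [fE f1l]]]].
  rewrite expr0 mul1r in fE; rewrite fE in fg *.
  have := yregular_inj fg (yregularM f1l gm) => /eqP.
  by rewrite eqn_add2r => /eqP ->.
by have [] := fg; rewrite fE exprS -!mulrA fcoefXM eqxx.
Qed.

(** Elements of K[[x]], kept in the two-variable ring so that the same substitution [fcomp] handles
    roots y = a(x). *)
Definition xonly f : Prop := forall i j, (0 < j)%N -> coef f i j = 0.

Lemma fcomp_xonly a b b' f : xonly f -> fcomp a b f = fcomp a b' f.
Proof.
move=> f0; apply: fps2P => i j; rewrite !coef_fcomp.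
apply: eq_bigr => k _; apply: eq_bigr => -[[|l] ll] _; first by [].
by rewrite [coef f k _]f0 ?mul0r.
Qed.

Lemma fcompX_xonly b f : xonly f -> fcomp X b f = f.
Proof. by move=> /(@fcomp_xonly X b Y) ->; rewrite fcomp_id. Qed.

Lemma coef_fcompX0 f i j :
  coef (fcomp X 0 f) i j = if j == 0%N then coef f i 0 else 0.
Proof.
pose r : S := Fps2 (fun i j => if j == 0%N then coef f i 0 else 0).
have [|g gE] := @divYnP K 1 (f - r).
  by move=> i' [|j'] // _; rewrite fcoefB /= subrr.
have x0 := @inmx1X K.
suff -> : fcomp X 0 f = r by [].
rewrite -[f in LHS](subrK r) gE linearD /= fcompM ?fcompXn ?fcompY //.
by rewrite expr0n mul0r add0r fcompX_xonly // => i' [].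
Qed.

Lemma xonly_fcomp0 f : xonly (fcomp X 0 f).
Proof. by move=> i [|j] // _; rewrite coef_fcompX0. Qed.

Lemma fcomp_ramify a b e N f : (0 < N)%N -> inmx 1 a -> inmx 1 b -> inmx 1 e ->
  fcomp a b (fcomp (X ^+ N) e f) = fcomp (a ^+ N) (fcomp a b e) f.
Proof.
move=> N0 a0 b0 e0; rewrite (fcompA f a0 b0 (inmxXX K N0) e0).
by rewrite (fcompXn a0 b0) (fcompX a0 b0).
Qed.

Lemma xonly_fcomp N f : (0 < N)%N -> xonly f -> xonly (fcomp (X ^+ N) Y f).
Proof.
move=> N0 fx; suff -> : fcomp (X ^+ N) Y f = fcomp X 0 (fcomp (X ^+ N) Y f).
  exact: xonly_fcomp0.
rewrite (fcomp_ramify f N0 (inmx1X K) (@inmx0 K 1%N) (inmx1Y K)).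
exact: fcomp_xonly.
Qed.

Lemma dy_xonly f : xonly f -> dy f = 0.
Proof. by move=> fx; apply: fps2P => i j /=; rewrite fx // mul0rn. Qed.

Lemma yregular_subY r : inmx 1 r -> xonly r -> yregular (Y - r) 1.
Proof.
move=> r0 rx; split=> [|[|] //]; first by rewrite fcoefB rx // subr0 oner_eq0.
by rewrite fcoefB r0 // subr0.
Qed.

(* Implicit function theorem: divide Y by f. *)
Lemma yregular1_root f : yregular f 1 ->
  exists r, [/\ inmx 1 r, xonly r & fcomp X r f = 0].
Proof.
move=> f1; have [q [r [YE r0]]] := weierstrass_division f1 Y.
have rm : inmx 1 r.
  apply/inmx1E; have := congr1 (fun h => coef h 0 0) YE.
  by rewrite fcoefD fcoef00M f1.2 // mulr0 add0r.
have x0 := @inmx1X K.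
have qu : q \is a GRing.unit.
  have : yregular (q * f) (0 + 1).
    have -> : q * f = Y - r by rewrite YE addrK.
    exact: yregular_subY.
  by move=> /yregular_divr /(_ f1) []; rewrite fps_unitE.
exists r; split=> //; apply: (@mulfI _ (fcomp X r q)).
  by apply: contraTneq qu => q0; rewrite -(fcomp_unit X r) q0 unitr0.
rewrite mulr0 -fcompM // (_ : q * f = Y - r); last by rewrite YE addrK.
by rewrite linearB /= fcompY // fcompX_xonly // subrr.
Qed.

Lemma coef_iter_dy k f i j :
  coef (iter k (@dy K) f) i j = coef f i (j + k) *+ ((j + k) ^_ k).
Proof.
elim: k j => [|k IH] j; first by rewrite addn0 ffactn0 mulr1n.
rewrite iterS -[LHS]/(coef (iter k (@dy K) f) i j.+1 *+ j.+1) IH.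
by rewrite -mulrnA ffactnSr -addSnnS addnK.
Qed.

Lemma coefYC_exp c l i j :
  coef ((Y + fC c) ^+ l) i j = if i == 0%N then (('X + c%:P) ^+ l)`_j else 0.
Proof.
elim: l i j => [|l IH] i j.
  by rewrite !expr0 fcoef1 coef1; case: i; case: j.
rewrite !exprS mulrDl -scale_fpsE fcoefD fcoefZ fcoefYM IH mulrDl coefD coefCM coefXM.
case: i => [|i] /=; last by rewrite mulr0 addr0; case: j => // j; rewrite IH.
by case: j => [|j]; rewrite ?IH.
Qed.
End Regular.

(** * Puiseux roots from the Newton polygon *)

Section Puiseux.
Variable K : numClosedFieldType.
Local Notation S := (fps2 K).
Local Notation X := (fX K).
Local Notation Y := (fY K).
Implicit Types (f g h u : S) (c : K).

(** f is a series in y, so no single coefficient gives the translation. The n-th derivative in y is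
    regular of order 1; its root b works, because the coefficient of y^n is that derivative at y = 0
    up to n!. *)
Lemma tschirnhaus f n : yregular f n.+1 -> exists b,
  [/\ inmx 1 b, xonly b & forall i, coef (fcomp X (Y + b) f) i n = 0].
Proof.
move=> [fn f0]; have [|b [b0 bx bE]] := @yregular1_root K (iter n (@dy K) f).
  split=> [|[|] //]; rewrite coef_iter_dy.
    by rewrite mulrn_eq0 negb_or fn andbT -lt0n ffact_gt0 leq_addl.
  by rewrite f0 ?mul0rn.
exists b; split=> // i.
have x0 := @inmx1X K; have Yb0 : inmx 1 (Y + b) by apply: inmxD (inmx1Y K) b0.
have dyE k : iter k (@dy K) (fcomp X (Y + b) f) = fcomp X (Y + b) (iter k (@dy K) f).
  elim: k => // k IH; rewrite !iterS IH dy_fcomp // linearD /=.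
  by rewrite dyX dyY (dy_xonly bx) mulr0 add0r addr0 mulr1.
have : coef (iter n (@dy K) (fcomp X (Y + b) f)) i 0 = 0.
  have <- : coef (fcomp X 0 (iter n (@dy K) (fcomp X (Y + b) f))) i 0 =
    coef (iter n (@dy K) (fcomp X (Y + b) f)) i 0 by rewrite coef_fcompX0.
  rewrite dyE fcompA // fcompX //.
  have -> : fcomp X 0 (Y + b) = b.
    by rewrite linearD /= fcompY // add0r fcompX_xonly.
  by rewrite bE.
rewrite coef_iter_dy add0n ffactnn => /eqP.
by rewrite mulrn_eq0 -[n`! == _]negbK -lt0n fact_gt0 => /eqP.
Qed.

Lemma two_roots (p : {poly K}) n : size p = n.+2 -> p`_n = 0 ->
  (exists2 j, (j <= n)%N & p`_j != 0) ->
  exists c d, [/\ c != d, root p c & root p d].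
Proof.
move=> sp pn [j jn pj].
have [r pE] := closed_field_poly_normal p.
have p0 : lead_coef p != 0 by rewrite lead_coef_eq0 -size_poly_eq0 sp.
have sr : size r = n.+1.
  by move: sp; rewrite pE size_scale // size_prod_XsubC => -[].
have rootr z : z \in r -> root p z.
  by move=> zr; rewrite pE rootZ // root_prod_XsubC.
case: r => // c r in pE sr rootr *.
have [|/allPn [d dr cd]] := boolP (all (pred1 c) r); last first.
  exists d, c; split=> //; apply: rootr; rewrite inE ?eqxx ?dr ?orbT //.
move=> /all_pred1P rE.
have rcE : c :: r = nseq n.+1 c by rewrite rE; case: sr => ->.
have c0 : c = 0.
  have := @coefPn_prod_XsubC K (c :: r) isT; rewrite sr [n.+1.-1]/=.
  have -> : (\prod_(z <- c :: r) ('X - z%:P))`_n = 0.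
    by apply: (mulfI p0); rewrite -coefZ -pE pn mulr0.
  rewrite rcE big_nseq iter_addr_0 => /eqP.
  by rewrite eq_sym oppr_eq0 mulrn_eq0 => /eqP.
case/eqP: pj; rewrite pE rcE c0 big_nseq iter_mulr_1 subr0 coefZ coefXn.
by rewrite ltn_eqF ?mulr0 // ltnS.
Qed.

(** The slope i / (n - j) is minimized, written with cross products. Multiplying by n! makes all
    slopes natural numbers, so a minimum exists although f has infinitely many monomials. *)
Lemma min_slope f n : yregular f n -> (exists i j, (j < n)%N /\ coef f i j != 0) ->
  exists i0 j0, [/\ (0 < i0)%N, (j0 < n)%N, coef f i0 j0 != 0 &
    forall i j, (j < n)%N -> coef f i j != 0 -> (i0 * (n - j) <= i * (n - j0))%N].
Proof.
move=> [_ f0] [i1 [j1 [j1n f1]]].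
pose L j := (n`! %/ (n - j))%N.
have LE j : (j < n)%N -> (L j * (n - j) = n`!)%N.
  by move=> jn; rewrite divnK // dvdn_fact // subn_gt0 jn leq_subr.
pose P m := `[< exists i j, [/\ (j < n)%N, coef f i j != 0 & m = (i * L j)%N] >].
have /ex_minnP [m /asboolP [i [j [jn fij ->]]] mmin] : exists m, P m.
  by exists (i1 * L j1)%N; apply/asboolP; exists i1, j1.
exists i, j; split=> //; first by case: i fij {mmin} => //; rewrite f0 ?eqxx.
move=> k l ln fkl.
have : (i * L j <= k * L l)%N by apply: mmin; apply/asboolP; exists k, l.
move=> /(leq_mul (leqnn ((n - j) * (n - l)))).
have -> : ((n - j) * (n - l) * (i * L j) = i * (n - l) * (L j * (n - j)))%N by ring.
have -> : ((n - j) * (n - l) * (k * L l) = k * (n - j) * (L l * (n - l)))%N by ring.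
by rewrite !LE // leq_pmul2r // fact_gt0.
Qed.

Lemma coef_fcomp_slope f a m c p q :
  coef (fcomp (X ^+ m) (X ^+ a * (Y + fC c)) f) p q =
  \sum_(k < (p + q).+1) \sum_(l < (p + q).+1)
    coef f k l * (if (m * k + a * l == p)%N then (('X + c%:P) ^+ l)`_q else 0).
Proof.
rewrite coef_fcomp; apply: eq_bigr => k _; apply: eq_bigr => l _.
rewrite exprMn -!exprM mulrA -exprD.
rewrite fcoefXnM coefYC_exp subn_eq0 eqn_leq; congr (_ * _).
by case: leqP.
Qed.

Lemma sum_ord_widen (n m : nat) (F : nat -> K) : (n <= m)%N ->
  (forall i, (n <= i)%N -> F i = 0) -> \sum_(i < m) F i = \sum_(i < n) F i.
Proof.
move=> nm F0; rewrite (big_ord_widen m F nm) [RHS]big_mkcond.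
by apply: eq_bigr => i _; case: ltnP => // /F0.
Qed.

(** The characteristic polynomial of the edge m k + a l = a n of the Newton polygon. *)
Definition slope_poly f n a m : {poly K} :=
  \poly_(l < n.+1) \sum_(k < (a * n).+1 | (m * k + a * l == a * n)%N) coef f k l.

(** The monomial x^k y^l acquires order m k + a l in x, at least a n by the slope condition. The
    terms reaching a n are those on the edge, evaluated at y + c. *)
Lemma slope_transform f n a m c : (0 < a)%N -> (0 < m)%N ->
  (forall i j, (j < n)%N -> coef f i j != 0 -> (a * (n - j) <= i * m)%N) ->
  exists g, fcomp (X ^+ m) (X ^+ a * (Y + fC c)) f = X ^+ (a * n) * g /\
    forall q, coef g 0 q = (slope_poly f n a m \Po ('X + c%:P))`_q.
Proof.
move=> a0 m0 slope.
have [p q pan|g gE] :=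
  @divXnP K (a * n) (fcomp (X ^+ m) (X ^+ a * (Y + fC c)) f).
  rewrite coef_fcomp_slope big1 // => k _; rewrite big1 // => l _.
  have [->|fkl] := eqVneq (coef f k l) 0; first by rewrite mul0r.
  rewrite [X in if X then _ else _](_ : _ = false) ?mulr0 //.
  apply/negbTE; rewrite neq_ltn; apply/orP; right; apply: leq_trans pan _.
  case: (ltnP l n) => ln; last by rewrite (leq_trans _ (leq_addl _ _)) ?leq_mul.
  by have := slope _ _ ln fkl; nia.
exists g; split=> // q.
have -> : coef g 0 q = coef (X ^+ (a * n) * g) (a * n) q.
  by rewrite fcoefXnM leqnn subnn.
rewrite -gE coef_fcomp_slope /slope_poly poly_def raddf_sum coef_sum exchange_big /=.
pose T l := \sum_(k < (a * n + q).+1)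
  coef f k l * (if (m * k + a * l == a * n)%N then (('X + c%:P) ^+ l)`_q else 0).
have n_an : (n <= a * n)%N by rewrite leq_pmull.
rewrite (@sum_ord_widen n.+1 _ T); first last.
- move=> l nl; rewrite /T big1 // => k _; rewrite (_ : _ == _ = false) ?mulr0 //.
  by apply/negbTE; nia.
- by rewrite ltnS; lia.
apply: eq_bigr => l _; rewrite comp_polyZ comp_Xn_poly coefZ mulr_suml.
rewrite /T (@sum_ord_widen (a * n).+1 _ (fun k => coef f k l *
  (if (m * k + a * l == a * n)%N then (('X + c%:P) ^+ l)`_q else 0))).
- rewrite [RHS]big_mkcond; apply: eq_bigr => k _.
  by case: ifP => //; rewrite mulr0.
- by rewrite ltnS leq_addr.
move=> k ank; rewrite (_ : _ == _ = false) ?mulr0 //; apply/negbTE; nia.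
Qed.

(** The edge polynomial has degree n + 1 and no term of degree n, hence two distinct roots.
    Centering at one of them leaves an order in y that is positive but at most n. *)
Lemma slope_step f n : yregular f n.+1 -> (forall i, coef f i n = 0) ->
  (exists i, coef f i 0 != 0) ->
  exists a m c g k, [/\ (0 < a)%N, (0 < m)%N, (0 < k < n.+1)%N, yregular g k &
    fcomp (X ^+ m) (X ^+ a * (Y + fC c)) f = X ^+ (a * n.+1) * g].
Proof.
move=> fn fn0 [i fi0].
have [|a [j0 [a0 j0n faj slope]]] := min_slope fn.
  by exists i, 0%N.
(* The slope is a / m; common factors are kept, which only enlarges the ramification. *)
pose m := (n.+1 - j0)%N; have m0 : (0 < m)%N by rewrite subn_gt0.
pose p := slope_poly f n.+1 a m.
have pn1 : p`_n.+1 = coef f 0 n.+1.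
  rewrite coef_poly ltnSn (big_pred1 ord0) // => k /=.
  by rewrite -[X in _ == X]add0n eqn_add2r muln_eq0 (gtn_eqF m0).
have pn : p`_n = 0.
  by rewrite coef_poly ltnS leqnSn big1 // => k _; rewrite fn0.
have pj : p`_j0 = coef f a j0.
  have alt : (a < (a * n.+1).+1)%N by rewrite ltnS leq_pmulr.
  rewrite coef_poly ltnS (ltnW j0n) (big_pred1 (Ordinal alt)) // => k /=.
  rewrite [X in _ == X](_ : _ = m * a + a * j0)%N ?eqn_add2r ?eqn_pmul2l //.
  by rewrite [(m * a)%N]mulnC -mulnDr subnK // ltnW.
have sp : size p = n.+2.
  apply/eqP; rewrite eqn_leq size_poly /=.
  rewrite ltnNge; apply/negP => sp.
  by have [] := fn; rewrite -pn1 nth_default ?eqxx.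
have [|c [d [cd pc pd]]] := two_roots sp pn.
  by exists j0; rewrite ?pj //.
have [g [gE gP]] := slope_transform c a0 m0 slope.
pose p1 := p \Po ('X + c%:P).
have sp1 : size p1 = n.+2 by rewrite size_comp_poly2 ?size_XaddC.
have p1n : p1`_n.+1 != 0.
  have : lead_coef p1 != 0 by rewrite lead_coef_eq0 -size_poly_eq0 sp1.
  by rewrite lead_coefE sp1.
have /ex_minnP [k p1k kmin] : exists k, p1`_k != 0 by exists n.+1.
have p10 j : (j < k)%N -> p1`_j = 0.
  move=> jk; apply/eqP; apply: contrapT => /negP /kmin.
  by rewrite leqNgt jk.
exists a, m, c, g, k; split=> //; last by split=> [|j jk]; rewrite gP //; apply: p10.
apply/andP; split.
  case: k p1k {kmin p10} => //; rewrite -horner_coef0 horner_comp !hornerE.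
  by rewrite (rootP pc) eqxx.
(* For k = n + 1 the translated polynomial would be a multiple of X^(n+1), with 0 as only root, but
   d - c is another one. *)
rewrite ltn_neqAle kmin // andbT; apply/eqP => kn.
have p1E : p1 = p1`_n.+1 *: 'X^(n.+1).
  apply/polyP => j; rewrite coefZ coefXn; case: (ltngtP j n.+1) => jn.
  - by rewrite p10 ?kn ?mulr0.
  - by rewrite nth_default ?mulr0 // sp1.
  - by rewrite jn mulr1.
have : p1.[d - c] = 0.
  by rewrite /p1 horner_comp !hornerE subrK (rootP pd).
rewrite p1E !hornerE => /eqP; rewrite mulf_eq0 (negPf p1n) /= expf_eq0 /=.
by rewrite subr_eq0 eq_sym (negPf cd).
Qed.

(** Strong induction on the order: order 1 is the implicit function theorem, and otherwise
    [slope_step] lowers the order after [tschirnhaus]. *)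
Lemma puiseux_root n f : (0 < n)%N -> yregular f n ->
  exists N a, [/\ (0 < N)%N, inmx 1 a & fcomp (X ^+ N) a f = 0].
Proof.
have x0 := @inmx1X K; have y0 := @inmx1Y K; have z0 : inmx 1 (0 : S) by [].
elim/ltn_ind: n f => -[|[|n]] // IH f _ fn.
  have [a [a0 _ fa]] := yregular1_root fn.
  by exists 1%N, a; rewrite expr1.
have [b [b0 bx fb]] := tschirnhaus fn.
have Yb0 : inmx 1 (Y + b) by apply: inmxD.
set F := fcomp X (Y + b) f in fb.
suff [N [a [N0 a0 Fa]]] : exists N a,
    [/\ (0 < N)%N, inmx 1 a & fcomp (X ^+ N) a F = 0].
  have xN := @inmxXX K N N0.
  exists N, (fcomp (X ^+ N) a (Y + b)); split; [by [] | exact: fcomp_inmx |].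
  have FE := fcompA f xN a0 x0 Yb0.
  by rewrite (fcompX xN a0) in FE; rewrite -FE.
have Fn : yregular F n.+2.
  rewrite /F -[X]mulr1; apply: yregular_fcomp fn.
  by rewrite -[b]opprK; apply: yregular_subY; [apply: inmxN | move=> i j ij; rewrite fcoefN bx ?oppr0].
(* Without a pure power of x, y divides F and the root is 0. *)
have [[i Fi0]|F0] := pselect (exists i, coef F i 0 != 0); last first.
  exists 1%N, 0; split; [by [] | by [] | rewrite expr1].
  have [|g ->] := @divYnP K 1 F.
    move=> i [|j] // _; apply/eqP; apply: contrapT => /negP Fi.
    by apply: F0; exists i.
  by rewrite fcompM // fcompXn // fcompY // expr1 mul0r.
have [|a [m [c [g [k [a0 m0 /andP[k0 kn] gk FE]]]]]] := slope_step Fn fb.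
  by exists i.
have [N [e [N0 e0 ge]]] := IH k kn g k0 gk.
have xN := @inmxXX K N N0; have xm := @inmxXX K m m0.
have xa : inmx 1 (X ^+ a * (Y + fC c)) by apply/inmxMr/inmxXX.
exists (N * m)%N, (fcomp (X ^+ N) e (X ^+ a * (Y + fC c))); split.
- by rewrite muln_gt0 N0.
- exact: fcomp_inmx.
have -> : X ^+ (N * m) = fcomp (X ^+ N) e (X ^+ m).
  by rewrite fcompXn // fcompX // exprM.
by rewrite -fcompA // FE fcompM // ge mulr0.
Qed.

(** Each root splits off one factor; earlier roots are pulled back along the ramification that the
    later ones require. *)
Lemma puiseux_factor n f : yregular f n -> exists N (r : seq S) u,
  [/\ (0 < N)%N, u \is a GRing.unit,
   forall a, a \in r -> inmx 1 a /\ xonly a &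
   fcomp (X ^+ N) Y f = u * \prod_(a <- r) (Y - a)].
Proof.
have x0 := @inmx1X K; have y0 := @inmx1Y K; have z0 : inmx 1 (0 : S) by [].
elim: n f => [|n IH] f fn.
  exists 1%N, [::], f; split=> //; first by rewrite fps_unitE; case: fn.
  by rewrite big_nil mulr1 expr1 fcomp_id.
have [N [a' [N0 a'0 fa']]] := puiseux_root (ltn0Sn n) fn.
(* The root found may involve y; setting y = 0 keeps it a root and makes it a series in x. *)
pose a := fcomp X 0 a'.
have ax : xonly a by apply: xonly_fcomp0.
have a0 : inmx 1 a by apply: fcomp_inmx.
have xN := @inmxXX K N N0.
have fa : fcomp X a (fcomp (X ^+ N) Y f) = 0.
  rewrite (fcomp_ramify f N0 x0 a0 y0) (fcompY x0 a0).
  by rewrite -(fcomp_ramify f N0 x0 z0 a'0) fa' linear0.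
set F := fcomp (X ^+ N) Y f in fa.
have Ya := yregular_subY a0 ax.
(* The remainder is a series in x, so evaluating at y = a shows that it vanishes. *)
have [q [r [FE rx]]] := weierstrass_division Ya F.
have r0 : r = 0.
  move: fa; rewrite FE linearD /= (fcompM x0 a0) linearB /= (fcompY x0 a0).
  by rewrite (fcompX_xonly a ax) (fcompX_xonly a rx) subrr mulr0 add0r.
rewrite r0 addr0 in FE.
have [|N' [s [u [N'0 uu sP qE]]]] := IH q.
  apply: (yregular_divr (m := 1)) Ya; rewrite -FE addn1 /F.
  case: N N0 {xN fa F FE fa'} => // N _; rewrite exprS.
  by apply: yregular_fcomp fn; apply: (yregularYn K 1).
have xN' := @inmxXX K N' N'0.
exists (N' * N)%N, (fcomp (X ^+ N') Y a :: s), u; split.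
- by rewrite muln_gt0 N0 N'0.
- exact: uu.
- move=> e; rewrite inE => /orP [/eqP ->|/sP //].
  by split; [apply: fcomp_inmx | apply: xonly_fcomp].
have -> : fcomp (X ^+ (N' * N)) Y f = fcomp (X ^+ N') Y F.
  by rewrite /F (fcomp_ramify f N0 xN' y0 y0) (fcompY xN' y0) exprM.
by rewrite FE (fcompM xN' y0) qE linearB /= (fcompY xN' y0) big_cons; ring.
Qed.
End Puiseux.

(** * Teissier's lemma *)

Section Teissier.
Variable K : numClosedFieldType.
Local Notation S := (fps2 K).
Local Notation X := (fX K).
Local Notation Y := (fY K).
Implicit Types (f g h u a : S) (c : K).

Lemma interXY : intersection_number X Y = 1%N.
Proof. exact/inter_eq/codim_XY. Qed.

Lemma finite2XY : finite2 X Y.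
Proof. by exists 1%N; split; [apply: ideal2_l | apply: ideal2_r]. Qed.

Lemma finite2_interX_yregular f n : yregular f n ->
  finite2 X f /\ intersection_number X f = n.
Proof.
move=> /yregularP [g [u [uu ->]]]; rewrite addrC [X * g]mulrC.
have fin : finite2 X (Y ^+ n * u).
  by apply: finite2M; [apply/finite2X/finite2XY | apply: finite2_unit].
split; first exact: finite2D.
rewrite interD interM // interX ?interXY ?inter_unit ?muln1 ?addn0 //.
exact: finite2XY.
Qed.

Lemma xonly_Xn h : h != 0 -> xonly h ->
  exists k u, u \is a GRing.unit /\ h = X ^+ k * u.
Proof.
move=> /yregular_Xn [k [n [g [-> [gn g0]]]]] hx.
exists k, g; split=> //; rewrite fps_unitE.
case: n gn {g0} => // n; have := hx k n.+1 isT.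
by rewrite fcoefXnM leqnn subnn => ->; rewrite eqxx.
Qed.

(** Division by [Y - a] leaves g(x, a(x)) as remainder, so the intersection number is the order of g
    along the parametrized branch. *)
Lemma inter_smooth a g k u : inmx 1 a -> xonly a -> u \is a GRing.unit ->
  fcomp X a g = X ^+ k * u ->
  finite2 (Y - a) g /\ intersection_number (Y - a) g = k.
Proof.
move=> a0 ax uu ga; have Ya := yregular_subY a0 ax.
have [q [r [gE rx]]] := weierstrass_division Ya g.
have rE : r = X ^+ k * u.
  have x0 := @inmx1X K; rewrite -ga gE linearD /= (fcompM x0 a0) linearB /= (fcompY x0 a0).
  by rewrite (fcompX_xonly a ax) (fcompX_xonly a rx) subrr mulr0 add0r.
have [fin iX] := finite2_interX_yregular Ya.
have fin' := finite2C fin; rewrite interC in iX.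
have fu : finite2 (Y - a) u by apply: finite2_unit.
rewrite gE [_ + r]addrC rE; split.
  by apply: finite2D; apply: finite2M => //; apply: finite2X.
rewrite interD interM ?interX ?iX ?muln1 ?inter_unit ?addn0 //.
by apply: finite2M => //; apply: finite2X.
Qed.

Lemma finite2_Mleft f g h : finite2 f h -> finite2 g h -> finite2 (f * g) h.
Proof. by move=> /finite2C fh /finite2C gh; apply/finite2C/finite2M. Qed.

Lemma interM_left f g h : finite2 f h -> finite2 g h ->
  intersection_number (f * g) h =
  (intersection_number f h + intersection_number g h)%N.
Proof.
move=> fh gh; rewrite ![intersection_number _ h]interC interM //.
by apply: finite2M; apply: finite2C.
Qed.

Lemma inter_factors (r : seq S) u g g' : u \is a GRing.unit ->
  (forall p, p \in r -> [/\ finite2 p g, finite2 p g' &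
    intersection_number p g = intersection_number p g']) ->
  [/\ finite2 (u * \prod_(p <- r) p) g, finite2 (u * \prod_(p <- r) p) g' &
    intersection_number (u * \prod_(p <- r) p) g =
    intersection_number (u * \prod_(p <- r) p) g'].
Proof.
move=> uu; elim: r => [|p r IH] H.
  rewrite big_nil mulr1; split; try by apply/finite2C/finite2_unit.
  by rewrite ![intersection_number u _]interC !inter_unit.
have [|fin fin' E] := IH; first by move=> q qr; apply: H; rewrite inE qr orbT.
have [|pg pg' pE] := H p; first by rewrite inE eqxx.
rewrite big_cons mulrCA; split; try exact: finite2_Mleft.
by rewrite (interM_left pg fin) (interM_left pg' fin') pE E.
Qed.

Lemma teissier_yregular f n : coef f 0 0 = 0 -> yregular (dy f) n ->
  finite2 (dy f) f -> finite2 (dy f) (dx f) /\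
  intersection_number (dy f) f = (intersection_number (dy f) (dx f) + n)%N.
Proof.
move=> f00 fn fin.
have x0 := @inmx1X K; have y0 := @inmx1Y K; have z0 : inmx 1 (0 : S) by [].
have [N [r [u [N0 uu rP fyE]]]] := puiseux_factor fn.
have xN := @inmxXX K N N0.
have NK : N%:R != 0 :> K by rewrite pnatr_eq0 -lt0n.
have := (finite2_basechange N0 (dy f) f).1 fin; rewrite fyE => finN.
have branch a : a \in r ->
    [/\ finite2 (Y - a) (fcomp (X ^+ N) Y f),
        finite2 (Y - a) (fcomp (X ^+ N) Y (X * dx f)) &
        intersection_number (Y - a) (fcomp (X ^+ N) Y f) =
        intersection_number (Y - a) (fcomp (X ^+ N) Y (X * dx f))].
  move=> ar; have [a0 ax] := rP a ar.
  have phiE g : fcomp X a (fcomp (X ^+ N) Y g) = fcomp (X ^+ N) a g.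
    by rewrite (fcomp_ramify g N0 x0 a0 y0) (fcompY x0 a0).
  have Ya0 : fcomp X a (Y - a) = 0.
    by rewrite linearB /= (fcompY x0 a0) (fcompX_xonly a ax) subrr.
  have fya : fcomp (X ^+ N) a (dy f) = 0.
    rewrite -phiE fyE (perm_big _ (perm_to_rem ar)) big_cons /= !(fcompM x0 a0).
    by rewrite Ya0 mul0r mulr0.
  have fa : finite2 (Y - a) (fcomp (X ^+ N) Y f).
    apply: finite2C; move: (finite2C finN).
    rewrite (perm_big _ (perm_to_rem ar)) big_cons /= mulrCA.
    exact: finite2Mr.
  have hx : xonly (fcomp (X ^+ N) a f).
    have -> : fcomp (X ^+ N) a f = fcomp X 0 (fcomp (X ^+ N) a f).
      by rewrite (fcomp_ramify f N0 x0 z0 a0) (fcompX_xonly 0 ax).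
    exact: xonly_fcomp0.
  (* If f vanished along the root, so would the whole ideal (y - a, f), which contains a power of
     x. *)
  have h0 : fcomp (X ^+ N) a f != 0.
    apply: contraTneq isT => h0; have [M [[s [t E]] _]] := fa.
    have := congr1 (fcomp X a) E; rewrite linearD /= !(fcompM x0 a0) Ya0 phiE h0.
    rewrite !mulr0 addr0 (fcompXn x0 a0) (fcompX x0 a0) => /eqP.
    by rewrite expf_eq0 (negPf (X_neq0 K)) andbF.
  have [k [v [vu hE]]] := xonly_Xn h0 hx.
  (* The order k is positive because f vanishes at the origin; so x d/dx, which multiplies the
     leading coefficient by k, preserves the order. *)
  have k0 : (0 < k)%N.
    case: k hE => // hE; move: vu; rewrite fps_unitE -[v]mul1r -(expr0 X) -hE.
    by rewrite fcomp00 f00 eqxx.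
  have [] := inter_smooth a0 ax vu (etrans (phiE f) hE) => _ ->.
  (* Let h = f(x^N, a) = x^k v. The chain rule gives x h' = N x^N (dx f)(x^N, a), since dy f
     vanishes there, and x h' = x^k (k v + x v'). Hence the factor 1 / N, and w is a unit because k
     is non-zero in K. *)
  pose w := N%:R^-1 *: (v *+ k + X * dx v).
  have [||fin' ->] := @inter_smooth a (fcomp (X ^+ N) Y (X * dx f)) k w a0 ax.
  - rewrite fps_unitE fcoefZ mulf_neq0 ?invr_eq0 // fcoefD fcoefXM addr0.
    rewrite -[v *+ k]scaler_nat fcoefZ mulf_neq0 ?pnatr_eq0 -?lt0n //.
    by rewrite -fps_unitE.
  - have := dx_fcomp f xN a0; rewrite fya mul0r addr0 hE => /(congr1 ( *%R X)).
    rewrite dxM mulrDr mulrA dx_expX [X in _ = X]mulrCA dx_expX => E.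
    rewrite phiE (fcompM xN a0) (fcompX xN a0) /w -fps_scaleAr.
    apply: (@scalerI _ _ N%:R) => //; rewrite scalerA mulfV // scale1r.
    rewrite scaler_nat [X ^+ N * _]mulrC -mulrnAr -E; ring.
  by split.
have [] := inter_factors (r := [seq Y - a | a <- r]) (g := fcomp (X ^+ N) Y f)
  (g' := fcomp (X ^+ N) Y (X * dx f)) uu.
  by move=> p /mapP [a ar ->]; apply: branch.
rewrite big_map -fyE => _ /(finite2_basechange N0 _ _).2 finX E.
have fin' := finite2Ml finX; split=> //.
(* The factor x of x dx f contributes i(dy f, x) = n. *)
have [fX iX] := finite2_interX_yregular fn.
move/eqP: E; rewrite !inter_basechange // eqn_pmul2l // => /eqP ->.
by rewrite interM // interC iX addnC.
Qed.
End Teissier.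

(** * Shears and generic directions *)

Section GenericDirection.
Variable K : numClosedFieldType.
Local Notation S := (fps2 K).
Local Notation X := (fX K).
Local Notation Y := (fY K).
Implicit Types (f g h u : S) (c : P1 K) (s t : K).

Local Notation shear s := (fcomp (X + s *: Y) Y).

Lemma shear_inmx s : inmx 1 (X + s *: Y).
Proof. by apply: inmxD; [apply: inmx1X | apply/inmxZ/inmx1Y]. Qed.

Lemma shearK s : cancel (shear s) (shear (- s)).
Proof.
have y0 := @inmx1Y K; move=> f; have s0 := shear_inmx (- s).
rewrite (fcompA f s0 y0 (shear_inmx s) y0) linearD linearZ /=.
by rewrite (fcompX s0 y0) (fcompY s0 y0) scaleNr subrK fcomp_id.
Qed.

Lemma dx_shear s f : dx (shear s f) = shear s (dx f).
Proof.
rewrite (dx_fcomp f (shear_inmx s) (inmx1Y K)) linearD linearZ /= dxX dxY.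
by rewrite scaler0 addr0 mulr1 mulr0 addr0.
Qed.

Lemma dy_shear s f : dy (shear s f) = shear s (s *: dx f + dy f).
Proof.
rewrite (dy_fcomp f (shear_inmx s) (inmx1Y K)) linearD linearZ /= dyX dyY.
by rewrite add0r mulr1 -fps_scaleAr mulr1 linearD linearZ.
Qed.

(** On the line x = 0 the sheared series is f(s y, y), whose coefficient of y^n is the homogeneous
    part of degree n at (s, 1). *)
Lemma coef_shear s f n :
  coef (shear s f) 0 n = (\poly_(k < n.+1) coef f k (n - k)).[s].
Proof.
have powE k g m : coef ((X + s *: Y) ^+ k * g) 0 m =
    if (k <= m)%N then s ^+ k * coef g 0 (m - k) else 0.
  elim: k m => [|k IH] m; first by rewrite !mul1r subn0.
  rewrite exprS -mulrA mulrDl fcoefD fcoefXM add0r -fps_scaleAl fcoefZ fcoefYM.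
  by case: m => [|m]; rewrite ?mulr0 // IH subSS ltnS; case: ifP;
    rewrite ?mulr0 // exprS mulrA.
rewrite coef_fcomp add0n horner_poly; apply: eq_bigr => k _.
have kn : (n - k < n.+1)%N by rewrite ltnS leq_subr.
have lE (l : nat) : coef ((X + s *: Y) ^+ k * Y ^+ l) 0 n = s ^+ k *+ (n - k == l)%N.
  rewrite powE -ltnS ltn_ord -[Y ^+ l]mul1r -(expr0 X) fcoef_monom.
  by rewrite eqxx mulr_natr.
under eq_bigr do rewrite lE.
rewrite (bigD1 (Ordinal kn)) // -[LHS]/(_ + _) big1 => [|l lk].
  by rewrite eqxx addr0.
rewrite (_ : _ == _ = false) ?mulr0n ?mulr0 //; apply/negbTE.
by apply: contraNneq lk => lE'; apply/eqP/val_inj.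
Qed.

(** The shear by s turns d/dy into the direction (s : 1), so (1 : t) calls for s = 1/t. *)
Lemma polar_shear t f : t != 0 ->
  dy (shear t^-1 f) = t^-1 *: shear t^-1 (polar (dx f, dy f) (Some t)).
Proof.
move=> t0; rewrite dy_shear /polar /= scale1r.
have -> : t^-1 *: dx f + dy f = t^-1 *: (dx f + t *: dy f).
  by rewrite scalerDr scalerA mulVf // scale1r.
by rewrite linearZ.
Qed.

(** The homogeneous part of degree n, dehomogenized by y = 1. *)
Definition initial_form f n : {poly K} := \poly_(k < n.+1) coef f k (n - k).

Lemma teissier f n t : has_multiplicity f n.+1 -> t != 0 ->
  ~~ root (initial_form f n.+1) t^-1 ->
  finite2 f (polar (dx f, dy f) (Some t)) ->
  intersection_number f (polar (dx f, dy f) (Some t)) = (milnor f + n)%N.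
Proof.
move=> [_ fm] t0 tr fin; set p := polar _ _ in fin *.
have y0 := @inmx1Y K; pose s := t^-1; have s0 : s != 0 by rewrite invr_eq0.
have sx := shear_inmx s; have sx' := shear_inmx (- s).
have K1 := shearK s; have K2 : cancel (shear (- s)) (shear s).
  by have := shearK (- s); rewrite opprK.
have Fm : inmx n.+1 (shear s f) by apply: fcomp_inmx.
have FyE : dy (shear s f) = s *: shear s p by rewrite polar_shear.
(* The root condition says that the sheared line x = 0 is not tangent to the curve: f has order n +
   1 on it, its multiplicity, and dy f order n. *)
have Fy : yregular (dy (shear s f)) n.
  split=> [|j jn].
    rewrite -[coef _ _ _]/(coef (shear s f) 0 n.+1 *+ n.+1).
    by rewrite -mulr_natr coef_shear mulf_neq0 // pnatr_eq0.
  by rewrite -[coef _ _ _]/(coef (shear s f) 0 j.+1 *+ j.+1) Fm ?mul0rn.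
have fin1 : finite2 (dy (shear s f)) (shear s f).
  rewrite FyE; apply: finite2C; apply: (finite2Z s0).
  exact: (finite2_comp sx y0 sx' y0 K2 fin).
have f00 : coef (shear s f) 0 0 = 0 by apply: Fm.
have [fin2 E] := teissier_yregular f00 Fy fin1.
have finx : finite2 (dx f) p.
  move: (finite2_comp sx' y0 sx y0 K1 fin2); rewrite dx_shear K1 FyE linearZ.
  rewrite /= K1 => /finite2C /(finite2Z t0).
  by rewrite scalerA mulfV // scale1r.
have iE : intersection_number (dy (shear s f)) (shear s f) =
    intersection_number f p.
  by rewrite interC FyE (interZ _ _ s0) (inter_comp sx y0 K1 K2).
(* Since t is non-zero, dx f and the polar generate the same ideal as dx f and dy f. *)
have ixE : intersection_number (dy (shear s f)) (dx (shear s f)) = milnor f.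
  rewrite interC dx_shear FyE (interZ _ _ s0).
  rewrite (inter_comp sx y0 K1 K2 finx).
  have -> : p = t *: dy f + 1 * dx f by rewrite /p /polar /= scale1r mul1r addrC.
  by rewrite interD (interZ _ _ t0).
by rewrite -iE E ixE.
Qed.

Lemma finite_roots (p : {poly K}) : p != 0 -> finite_set [set z | root p z].
Proof.
move=> p0; have [r pE] := closed_field_poly_normal p.
apply: (sub_finite_set _ (finite_seq r)) => z /=.
by rewrite pE rootZ ?lead_coef_eq0 // root_prod_XsubC.
Qed.

(** The excluded directions are the two coordinate ones, which the shear does not treat, and the
    finitely many given by roots of the initial form. *)
Lemma generically_teissier f n : has_multiplicity f n.+1 ->
  generically [set c | finite2 f (polar (dx f, dy f) c) ->
    intersection_number f (polar (dx f, dy f) c) = (milnor f + n)%N].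
Proof.
move=> fm; have p0 : initial_form f n.+1 != 0.
  have [[i [j [ij fij]]] _] := fm.
  apply: contraNneq fij => /(congr1 (fun q : {poly K} => q`_i)).
  by rewrite coef0 coef_poly ltnS -ij leq_addr addKn => ->.
rewrite /generically.
apply: (@sub_finite_set _ _ ([set None; Some 0] `|`
  (fun z => Some z^-1) @` [set z | root (initial_form f n.+1) z])).
  move=> [t|] H; last by left; left.
  have [->|t0] := eqVneq t 0; first by left; right.
  have [tr|tr] := boolP (root (initial_form f n.+1) t^-1).
    by right; exists t^-1 => //=; rewrite invrK.
  by case: H => /=; apply: teissier.
rewrite finite_setU; split; last exact/finite_image/finite_roots.
by rewrite finite_setU; split; apply: finite_set1.
Qed.
End GenericDirection.

(** * The GSV-index as an index of polars *)

Section GSVIndex.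
Variable K : numClosedFieldType.
Local Notation S := (fps2 K).
Implicit Types (f g h u : S) (c : P1 K) (w eta : oneform K) (F : foliation K).

Local Notation df f := (dx f, dy f).

Lemma irreducible_rel_prime f g : irreducible f -> ~ divides f g -> rel_prime g f.
Proof.
move=> [f0 fu irr] fg d [q gE] [r fE].
have [ru|//] := irr _ _ fE; case: fg; exists (q / r).
by rewrite gE fE -mulrA mulKr.
Qed.

Lemma divides_polar2 f w c c' : c != c' ->
  divides f (polar w c) -> divides f (polar w c') ->
  divides f w.1 /\ divides f w.2.
Proof.
have dvdB g h : divides f g -> divides f h -> divides f (g - h).
  by move=> [q ->] [r ->]; exists (q - r); rewrite mulrBl.
have dvdZ a g : divides f g -> divides f (a *: g).
  by move=> [q ->]; exists (a *: q); rewrite fps_scaleAl.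
have two t : divides f (polar w (Some t)) -> divides f w.2 -> divides f w.1.
  move=> p1 p2; have := dvdB _ _ p1 (dvdZ t _ p2).
  by rewrite /polar /= scale1r addrK.
have pN : divides f (polar w None) -> divides f w.2.
  by rewrite /polar /= scale0r add0r scale1r.
case: c c' => [t|] [t'|] //.
- move=> tt' pt pt'; suff w2 : divides f w.2 by split=> //; apply: two pt w2.
  have tt : t - t' != 0.
    by rewrite subr_eq0; apply: contraNneq tt' => ->.
  have := dvdZ (t - t')^-1 _ (dvdB _ _ pt pt').
  rewrite /polar /= opprD addrACA subrr add0r -scalerBl scalerA mulVf //.
  by rewrite scale1r.
- by move=> _ pt /pN w2; split=> //; apply: two pt w2.
by move=> _ /pN w2 pt; split=> //; apply: two pt w2.
Qed.

(** At most one member of the pencil is divisible by f: two of them would recover both coefficients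
    of w. *)
Lemma generically_rel_prime f w : irreducible f ->
  ~ (divides f w.1 /\ divides f w.2) ->
  generically [set c : P1 K | rel_prime (polar w c) f].
Proof.
move=> irr nd; rewrite /generically.
have [[c0 bad]|good] := pselect (exists c, divides f (polar w c)).
  apply: (@sub_finite_set _ _ [set c0]); last exact: finite_set1.
  move=> c /= nrp; apply: contrapT => /eqP cc0; case: nrp.
  apply: irreducible_rel_prime => // dvd; apply: nd.
  exact: divides_polar2 cc0 dvd bad.
apply: (@sub_finite_set _ _ set0) => // c /= nrp; case: nrp.
by apply: irreducible_rel_prime => // dvd; apply: good; exists c.
Qed.

Lemma multiplicity_exists f : f != 0 -> exists n, has_multiplicity f n.
Proof.
move=> /fps2_neq0 [i [j fij]].
have exn : exists n, `[< exists i j, (i + j)%N = n /\ coef f i j != 0 >].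
  by exists (i + j)%N; apply/asboolP; exists i, j.
have [n /asboolP fn nmin] := ex_minnP exn.
exists n; split=> // k l kl; apply/eqP; apply: contrapT => /negP fkl.
have : (n <= k + l)%N by apply: nmin; apply/asboolP; exists k, l.
by rewrite leqNgt kl.
Qed.

Lemma multiplicityE f n : has_multiplicity f n -> multiplicity f = n.
Proof.
move=> fn; apply: xget_unique => // m [[k [l [kl fkl]]] f0].
have [[i [j [ij fij]]] f0'] := fn.
case: (ltngtP m n) => // mn.
  by move: fkl; rewrite f0' ?eqxx // kl.
by move: fij; rewrite f0 ?eqxx // ij.
Qed.

(** In characteristic zero some partial derivative has order one less than f, hence is not a
    multiple of f. *)
Lemma irreducible_not_divides_df f : irreducible f ->
  ~ (divides f (dx f) /\ divides f (dy f)).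
Proof.
move=> [f0 fu _] [[q fx] [r fy]].
have [[|n] [[i [j [ij fij]]] fm]] := multiplicity_exists f0.
  case: i j ij fij => [|i] [|j] // _.
  by move: fu; rewrite nonunitE => ->.
have fxm : inmx n.+1 (dx f) by rewrite fx; apply: inmxMl.
have fym : inmx n.+1 (dy f) by rewrite fy; apply: inmxMl.
have charK k x : x *+ k.+1 = 0 -> x = 0 :> K.
  by move=> /eqP; rewrite mulrn_eq0 => /eqP.
case/eqP: fij; case: i ij => [|i] ij.
  by case: j ij => // j [ij]; apply: (charK j); apply: fym; rewrite -ij add0n.
by apply: (charK i); apply: fxm; move: ij; rewrite addSn => -[->].
Qed.

(** The finiteness clauses guard against the default value of [intersection_number]. *)
Definition polar_index w f (n : int) c : Prop :=
  [/\ finite2 f (polar w c), finite2 f (polar (df f) c) &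
      n = (intersection_number f (polar w c))%:Z -
          (intersection_number f (polar (df f) c))%:Z].

(** The decomposition is contracted with the constant vector field of direction c; modulo f only two
    products remain. *)
Lemma GSV_decomposition_polar w f g h eta c : GSV_decomposition w f g h eta ->
  g * polar w c = h * polar (df f) c + polar eta c * f.
Proof.
move=> [E1 E2]; rewrite /polar mulrDr -!fps_scaleAr E1 E2 /=.
by rewrite !scale_fpsE; ring.
Qed.

Lemma polar_index_irreducible w f g h eta c :
  rel_prime g f -> rel_prime h f -> GSV_decomposition w f g h eta ->
  rel_prime (polar w c) f -> rel_prime (polar (df f) c) f ->
  polar_index w f
    ((intersection_number f h)%:Z - (intersection_number f g)%:Z) c.
Proof.
move=> /rel_prime_finite2/finite2C gf /rel_prime_finite2/finite2C hf dec.
move=> /rel_prime_finite2/finite2C pf /rel_prime_finite2/finite2C df.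
split=> //.
have := congr1 (intersection_number f) (GSV_decomposition_polar c dec).
rewrite interD (interM (finite2M gf pf)) (interM (finite2M hf df)); lia.
Qed.

Lemma polar_dM f1 f2 c : polar (df (f1 * f2)) c =
  f2 * polar (df f1) c + polar (df f2) c * f1.
Proof. by rewrite /polar /= dxM dyM !scale_fpsE; ring. Qed.

(** Modulo f1 the polar of f1 f2 is f2 times the polar of f1, and symmetrically; each factor thus
    subtracts one i(f1, f2). *)
Lemma polar_index_union w f1 f2 n1 n2 c : rel_prime f1 f2 ->
  polar_index w f1 n1 c -> polar_index w f2 n2 c ->
  polar_index w (f1 * f2)
    (n1 + n2 - 2 * (intersection_number f1 f2)%:Z) c.
Proof.
move=> /rel_prime_finite2 f12 [p1 d1 ->] [p2 d2 ->].
have f21 := finite2C f12.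
have E2 : polar (df (f1 * f2)) c = f1 * polar (df f2) c + polar (df f1) c * f2.
  by rewrite mulrC polar_dM.
have fin1 := finite2M f12 d1; have fin2 := finite2M f21 d2.
have d1' : finite2 f1 (polar (df (f1 * f2)) c).
  by rewrite polar_dM; apply: finite2D.
have d2' : finite2 f2 (polar (df (f1 * f2)) c) by rewrite E2; apply: finite2D.
split; [exact: finite2_Mleft | exact: finite2_Mleft |].
rewrite (interM_left p1 p2) (interM_left d1' d2').
rewrite {1}polar_dM E2 !interD (interM fin1) (interM fin2) [intersection_number f2 f1]interC.
lia.
Qed.

Lemma irreducible_not_divides_form F f : irreducible f ->
  ~ (divides f (F : oneform K).1 /\ divides f (F : oneform K).2).
Proof. by move=> [_ /negP fu _] [dP dQ]; apply: fu; apply: (form_prime dP dQ). Qed.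

(** Induction on the derivation of [is_GSV]: each rule intersects two cofinite sets of
    directions. *)
Lemma GSV_polar F f n : is_GSV F f n -> generically [set c : P1 K | polar_index F f n c].
Proof.
elim=> {f n} [f g h eta irr inv gf hf dec|f1 f2 n1 n2 _ _ _ _ f12 _ IH1 _ IH2].
  have := generically_rel_prime irr (@irreducible_not_divides_form F _ irr).
  have := @generically_rel_prime _ (df f) irr (irreducible_not_divides_df irr).
  move=> H1 H2; apply: (sub_cofinite_set (A :=
    [set c : P1 K | rel_prime (polar F c) f] `&` [set c : P1 K | rel_prime (polar (df f) c) f])).
    by move=> c [p d]; exact: polar_index_irreducible gf hf dec p d.
  by rewrite cofinite_setI; split; [exact: H2 | exact: H1].
apply: (sub_cofinite_set (A :=
  [set c : P1 K | polar_index F f1 n1 c] `&` [set c : P1 K | polar_index F f2 n2 c])).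
  by move=> c [p1 p2]; exact: polar_index_union f12 p1 p2.
by rewrite cofinite_setI; split; [exact: IH1 | exact: IH2].
Qed.

Lemma invariant_mul w f g : invariant_curve w f -> invariant_curve w g ->
  invariant_curve w (f * g).
Proof.
move=> [k fk] [l gl]; exists (k + l); rewrite dxM dyM.
rewrite (_ : _ - _ = g * (w.1 * dy f - w.2 * dx f) + f * (w.1 * dy g - w.2 * dx g)).
  by rewrite fk gl; ring.
by ring.
Qed.

Lemma invariant_unit w u : u \is a GRing.unit -> invariant_curve w u.
Proof. by move=> uu; exists (u^-1 * (w.1 * dy u - w.2 * dx u)); rewrite mulVKr. Qed.

(* For f invariant, g = polar of f and h = polar of w give a decomposition. *)
Lemma is_GSV_irreducible_ex F f : irreducible f -> invariant_curve F f ->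
  exists n, is_GSV F f n.
Proof.
move=> irr [k inv].
have := generically_rel_prime irr (@irreducible_not_divides_form F _ irr).
have := @generically_rel_prime _ (df f) irr (irreducible_not_divides_df irr).
move=> H1 H2.
have [c [rF rf]] : exists c, rel_prime (polar F c) f /\ rel_prime (polar (df f) c) f.
  apply: contrapT => none.
  have : finite_set [set: P1 K].
    apply: (@sub_finite_set _ _ (~` [set c : P1 K | rel_prime (polar F c) f] `|`
      ~` [set c : P1 K | rel_prime (polar (df f) c) f])).
      move=> c _; apply: contrapT => /not_orP [/contrapT r1 /contrapT r2].
      by apply: none; exists c.
    by rewrite finite_setU; split; [exact: H2 | exact: H1].
  (* The naturals embed in the finite directions, as K has characteristic zero, so the projective
     line is infinite. *)
  move=> fin; have := infinite_nat; apply.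
  apply: (@sub_finite_set _ _ ((fun c : P1 K => if c is Some t then
    xget 0%N [set n | n%:R = t] else 0%N) @` [set: P1 K])).
    move=> n _; exists (Some n%:R) => //=.
    apply: xget_unique => // m; apply: mulrIn; exact: oner_neq0.
  exact: finite_image.
exists ((intersection_number f (polar F c))%:Z -
  (intersection_number f (polar (df f) c))%:Z).
(* For the direction (a : b), [g * w - h * df] is (b, - a) times w.1 dy f - w.2 dx f, which is f k
   by invariance; this gives [eta]. *)
apply: (is_GSV_irreducible (eta := ((hcoord c).2 *: k, - (hcoord c).1 *: k))) => //.
  by exists k.
split; rewrite /polar /=.
  rewrite -fps_scaleAr -inv !scale_fpsE; ring.
rewrite scaleNr mulrN -fps_scaleAr -inv !scale_fpsE; ring.
Qed.

(** An empty relation would leave [GSV] at its default value. Induction on N with f outside the N-th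
    power of the maximal ideal stands in for factorization: each non-unit factor has smaller order,
    and reducedness makes the factors coprime. *)
Lemma is_GSV_ex F f : reduced_curve f ->
  (forall g, irreducible g -> divides g f -> invariant_curve F g) ->
  invariant_curve F f /\ exists n, is_GSV F f n.
Proof.
move=> [f0 f00 fred] finv.
have [N] : exists N, ~ inmx N f.
  apply: contrapT => H; case/eqP: f0; apply: inmx_eq => N; rewrite subr0.
  by apply: contrapT => fN; apply: H; exists N.
elim: N f f0 f00 fred finv => [|N IH] f f0 f00 fred finv fN; first by case: fN.
have nu : f \isn't a GRing.unit by rewrite nonunitE f00.
have [irr|nirr] := pselect (irreducible f).
  have inv := finv f irr (ex_intro _ 1 (esym (mul1r f))).
  by split=> //; apply: is_GSV_irreducible_ex.
have [g [h [fE gu hu]]] : exists g h,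
    [/\ f = g * h, g \isn't a GRing.unit & h \isn't a GRing.unit].
  apply: contrapT => H; apply: nirr; split=> // g h fE.
  have [|gu] := boolP (g \is a GRing.unit); first by left.
  have [|hu] := boolP (h \is a GRing.unit); first by right.
  by case: H; exists g, h.
have g0 : g != 0 by apply: contraNneq f0 => g0; rewrite fE g0 mul0r.
have h0 : h != 0 by apply: contraNneq f0 => h0; rewrite fE h0 mulr0.
have g00 : coef g 0 0 = 0 by apply/eqP; rewrite -nonunitE.
have h00 : coef h 0 0 = 0 by apply/eqP; rewrite -nonunitE.
have gN : ~ inmx N g.
  by move=> gN; apply: fN; rewrite fE -addn1; apply: inmxM => //; apply/inmx1E.
have hN : ~ inmx N h.
  by move=> hN; apply: fN; rewrite fE -add1n; apply: inmxM => //; apply/inmx1E.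
have gred d : divides (d ^+ 2) g -> d \is a GRing.unit.
  by move=> [q gE]; apply: fred; exists (q * h); rewrite fE gE mulrAC.
have hred d : divides (d ^+ 2) h -> d \is a GRing.unit.
  by move=> [q hE]; apply: fred; exists (g * q); rewrite fE hE mulrA.
have gh : rel_prime g h.
  move=> d [q gE] [r hE]; apply: fred; exists (q * r).
  by rewrite fE gE hE mulrACA -expr2.
have [|ginv [n1 gn1]] := IH g g0 g00 gred _ gN.
  by move=> d dirr [q gE]; apply: finv => //; exists (q * h); rewrite fE gE mulrAC.
have [|hinv [n2 hn2]] := IH h h0 h00 hred _ hN.
  by move=> d dirr [q hE]; apply: finv => //; exists (g * q); rewrite fE hE mulrA.
rewrite fE; split; first exact: invariant_mul.
exists (n1 + n2 - 2 * (intersection_number g h)%:Z).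
by apply: is_GSV_union.
Qed.

Lemma zero_curve_invariant F (B : divisor F) f g : zero_curve B f ->
  irreducible g -> divides g f -> invariant_curve F g.
Proof.
move=> [_ comp] irr gf.
have : components f (curve_of g) by exists g.
rewrite comp /= /zero_part => B1.
have [|h [_ hinv gE]] := @mult_Sep _ _ B (curve_of g).
  by apply: contra_eq_neq B1 => ->.
(* Equal branches determine their equations up to a unit, which preserves invariance. *)
have : curve_of g g by exists 1; rewrite ?unitr1 ?mul1r.
by rewrite gE => -[u uu ->]; apply: invariant_mul => //; apply: invariant_unit.
Qed.

Lemma GSV_generic_polar F f : reduced_curve f ->
  (forall g, irreducible g -> divides g f -> invariant_curve F g) ->
  generically [set c : P1 K | GSV F f = (intersection_number (polar F c) f)%:Z
    - (milnor f)%:Z - (multiplicity f)%:Z + 1].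
Proof.
move=> fred finv; have [_ ex] := is_GSV_ex fred finv.
have [f0 f00 _] := fred.
(* f vanishes at the origin, so its multiplicity is some [n.+1] and mu + nu - 1 reads
   [milnor f + n]. *)
have [[|n] fn] := multiplicity_exists f0.
  by have [[[|i] [[|j] [//= _]]]] := fn; rewrite f00 eqxx.
have isG : is_GSV F f (GSV F f) by apply: xgetPex ex.
apply: (sub_cofinite_set (A := [set c : P1 K | polar_index F f (GSV F f) c] `&`
  [set c : P1 K | finite2 f (polar (df f) c) ->
    intersection_number f (polar (df f) c) = (milnor f + n)%N])).
  move=> c [[_ fin ->] /(_ fin) E] /=.
  rewrite E (multiplicityE fn) [intersection_number (polar _ _) f]interC; lia.
rewrite cofinite_setI; split; first exact: GSV_polar.
exact: generically_teissier.
Qed.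
End GSVIndex.

Theorem corollary5p3 (R : realType) (F : foliation R[i])
    (T : seq (ipoint R[i])) (B : divisor F) (f : fps2 R[i]) :
  reduction F T ->
  reduced_divisor B ->
  balanced T B ->
  zero_curve B f ->
  generically [set c : P1 R[i] |
    GSV F f = (intersection_number (polar F c) f)%:Z
              - (milnor f)%:Z - (multiplicity f)%:Z + 1].
Proof.
move=> _ _ _ Bf; apply: GSV_generic_polar; first by case: Bf.
by move=> g; apply: zero_curve_invariant Bf.
Qed.
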